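(* Let $V$ be an infinite-dimensional vector space over a field $\mathbb{F}$, and let $i\in\mathbb{F}^*$ be of order $4$ in the multiplicative group $\mathbb{F}^*$. Let $u\in\mathrm{SP}_f(V)$ have its determinant in $\{\pm 1,\pm i\}$. Then, in the algebra $\mathrm{End}(V)$, the automorphism $iu$ is the product of three involutions, and also the product of one involution and two unipotent elements of index $2$ (in any prescribed order).
   Context: $\mathrm{End}(V)$ is the algebra of all endomorphisms of $V$. $\mathrm{SP}_f(V)$ is the group of all automorphisms of $V$ of the form $\mathrm{id}_V+w$ with $w$ a finite-rank endomorphism of $V$. For $u\in\mathrm{SP}_f(V)$, the determinant of $u$ is the determinant of the endomorphism $u_{|W}$ of $W$ induced by $u$, where $W$ is any finite-dimensional linear subspace of $V$ that includes $\mathrm{Im}(u-\mathrm{id}_V)$ (this does not depend on the choice of $W$). In a unital algebra, an element $x$ is an involution if $x^2=1$, and is unipotent of index $2$ if $(x-1)^2=0$. *)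

(* Defs.v *)
From HB Require Import structures.
From mathcomp Require Import all_boot all_order all_algebra all_classical.

Set Implicit Arguments.
Unset Strict Implicit.
Unset Printing Implicit Defensive.

Import GRing.Theory.
Local Open Scope ring_scope.

(* The unital algebra End(V). Since V may be trivial, it is only a pzRingType
   (together with a compatible lmodType F structure), not an algType F. *)

Definition End (F : fieldType) (V : lmodType F) : Type := {linear V -> V}.

Section EndAlgebra.
Context (F : fieldType) (V : lmodType F).
Implicit Types f g h : End V.

Lemma EndP f g : (forall x, f x = g x) -> f = g.
Proof.
case: f g => [f [[f1] [f2]]] [g [[g1] [g2]]] /= fg.
have {}fg : f = g by apply: funext.
subst g; congr GRing.Linear.Pack.
by rewrite (Prop_irrelevance f1 g1) (Prop_irrelevance f2 g2).
Qed.

HB.instance Definition _ := gen_eqMixin (End V).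
HB.instance Definition _ := gen_choiceMixin (End V).

Definition End_zero : End V := \0.
Definition End_opp f : End V := \- (f : {linear V -> V}).
Definition End_add f g : End V := (f : {linear V -> V}) \+ (g : {linear V -> V}).
Definition End_one : End V := idfun.
Definition End_mul f g : End V := (f : {linear V -> V}) \o (g : {linear V -> V}).
Definition End_scale (a : F) f : End V := a \*: (f : {linear V -> V}).

Fact End_addA : associative End_add.
Proof. by move=> f g h; apply: EndP => x /=; rewrite addrA. Qed.
Fact End_addC : commutative End_add.
Proof. by move=> f g; apply: EndP => x /=; rewrite addrC. Qed.
Fact End_add0 : left_id End_zero End_add.
Proof. by move=> f; apply: EndP => x /=; rewrite add0r. Qed.
Fact End_addN : left_inverse End_zero End_opp End_add.
Proof. by move=> f; apply: EndP => x /=; rewrite addNr. Qed.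

HB.instance Definition _ :=
  GRing.isZmodule.Build (End V) End_addA End_addC End_add0 End_addN.

Fact End_mulA : associative End_mul.
Proof. by move=> f g h; apply: EndP. Qed.
Fact End_mul1l : left_id End_one End_mul.
Proof. by move=> f; apply: EndP. Qed.
Fact End_mul1r : right_id End_one End_mul.
Proof. by move=> f; apply: EndP. Qed.
Fact End_mulDl : left_distributive End_mul +%R.
Proof. by move=> f g h; apply: EndP. Qed.
Fact End_mulDr : right_distributive End_mul +%R.
Proof. by move=> f g h; apply: EndP => x /=; rewrite raddfD. Qed.

HB.instance Definition _ := GRing.Zmodule_isPzRing.Build (End V)
  End_mulA End_mul1l End_mul1r End_mulDl End_mulDr.

Fact End_scaleA a b f : End_scale a (End_scale b f) = End_scale (a * b) f.
Proof. by apply: EndP => x /=; rewrite scalerA. Qed.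
Fact End_scale1 : left_id 1 End_scale.
Proof. by move=> f; apply: EndP => x /=; rewrite scale1r. Qed.
Fact End_scaleDr : right_distributive End_scale +%R.
Proof. by move=> a f g; apply: EndP => x /=; rewrite scalerDr. Qed.
Fact End_scaleDl f : {morph End_scale^~ f : a b / a + b}.
Proof. by move=> a b; apply: EndP => x /=; rewrite scalerDl. Qed.

HB.instance Definition _ := GRing.Zmodule_isLmodule.Build F (End V)
  End_scaleA End_scale1 End_scaleDr End_scaleDl.

Lemma End_addE f g x : (f + g) x = f x + g x. Proof. by []. Qed.
Lemma End_oppE f x : (- f) x = - f x. Proof. by []. Qed.
Lemma End_oneE x : (1 : End V) x = x. Proof. by []. Qed.
Lemma End_mulE f g x : (f * g) x = f (g x). Proof. by []. Qed.
Lemma End_scaleE a f x : (a *: f) x = a *: f x. Proof. by []. Qed.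

Lemma End_scaleAl a f g : a *: (f * g) = (a *: f) * g.
Proof. by apply: EndP. Qed.
Lemma End_scaleAr a f g : a *: (f * g) = f * (a *: g).
Proof.
by apply: EndP => x; exact: esym (linearZ_LR (f : {linear V -> V}) a (g x)).
Qed.

End EndAlgebra.

Definition is_involution (A : pzRingType) (x : A) : Prop := x ^+ 2 = 1.

Definition is_unipotent2 (A : pzRingType) (x : A) : Prop := (x - 1) ^+ 2 = 0.

Section FiniteRank.
Context (F : fieldType) (V : lmodType F).

Definition in_span n (e : 'I_n -> V) (v : V) : Prop :=
  exists c : 'I_n -> F, v = \sum_i c i *: e i.

Definition lin_indep n (e : 'I_n -> V) : Prop :=
  forall c : 'I_n -> F, \sum_i c i *: e i = 0 -> forall i, c i = 0.

Definition infinite_dimensional : Prop :=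
  ~ exists n (e : 'I_n -> V), forall v, in_span e v.

Definition finite_rank (w : End V) : Prop :=
  exists n (e : 'I_n -> V), forall v, in_span e (w v).

Definition SPf (u : End V) : Prop :=
  bijective u /\ exists2 w : End V, finite_rank w & u = 1 + w.

(* d is the determinant of u restricted to some finite-dimensional subspace W
   that includes Im (u - 1): here e is a basis of W, and the rows of A are the
   coordinates in e of the images of the vectors of e (so A is the transpose
   of the matrix of u_|W with respect to e). *)
Definition is_restricted_det (u : End V) (d : F) : Prop :=
  exists n (e : 'I_n -> V) (A : 'M[F]_n),
    [/\ lin_indep e,
        forall v, in_span e ((u - 1) v),
        forall i, u (e i) = \sum_j A i j *: e j
      & d = \det A].

(* The default value 0 is only taken outside of SP_f(V): see SPf_detP. *)
Definition SPf_det (u : End V) : F := xget 0 [set d | is_restricted_det u d].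

End FiniteRank.

Arguments infinite_dimensional {F} V.

Section DeterminantWellDefined.
Context (F : fieldType) (V : lmodType F).
Implicit Types u w : End V.

Lemma det_1addM_comm m n (P : 'M[F]_(m, n)) (Q : 'M[F]_(n, m)) :
  \det (1%:M + P *m Q) = \det (1%:M + Q *m P).
Proof.
pose X : 'M[F]_(m + n) := block_mx 1%:M (- P) Q 1%:M.
have X1 : X = block_mx 1%:M 0 Q 1%:M *m block_mx 1%:M (- P) 0 (1%:M + Q *m P).
  rewrite mulmx_block !mul1mx !mulmx1 !mul0mx !addr0 mulmxN.
  by rewrite addrCA addNr addr0.
have X2 : X = block_mx 1%:M (- P) 0 1%:M *m block_mx (1%:M + P *m Q) 0 Q 1%:M.
  rewrite mulmx_block !mul1mx !mulmx1 !mul0mx ?mulmx0 !add0r mulNmx.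
  by rewrite addrK.
have := congr1 determinant X1; rewrite {1}X2 !det_mulmx.
by rewrite !det_lblock !det_ublock !det1 !mul1r !mulr1.
Qed.

Lemma lin_indep_inj n (e : 'I_n -> V) (c d : 'I_n -> F) : lin_indep e ->
  \sum_i c i *: e i = \sum_i d i *: e i -> forall i, c i = d i.
Proof.
move=> efree cd i; apply/eqP; rewrite -subr_eq0; apply/eqP.
apply: (efree (fun i => c i - d i)).
under eq_bigr do rewrite scalerBl.
by rewrite sumrB cd subrr.
Qed.

Lemma lin_indep_leq r n (f : 'I_r -> V) (e : 'I_n -> V) :
  lin_indep f -> (forall a, in_span e (f a)) -> (r <= n)%N.
Proof.
move=> ffree /choice [C fC]; rewrite leqNgt; apply/negP => ltnr.
pose M := \matrix_(a, j) C a j.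
have kM : kermx M != 0.
  rewrite -mxrank_eq0 mxrank_ker -lt0n subn_gt0.
  exact: leq_ltn_trans (rank_leq_col _) ltnr.
case/rowV0Pn: kM => x /sub_kermxP xM /negP; apply.
apply/eqP/rowP => a; rewrite mxE; apply: (ffree (x 0)).
under eq_bigr => b _ do rewrite fC scaler_sumr.
rewrite exchange_big big1 //= => j _.
under eq_bigr do rewrite scalerA.
rewrite -scaler_suml.
suff -> : \sum_b x 0 b * C b j = 0 by rewrite scale0r.
have := congr1 (fun N : 'rV_n => N 0 j) xM; rewrite !mxE => xM0.
by rewrite -[RHS]xM0; apply: eq_bigr => b _; rewrite mxE.
Qed.

Lemma image_basis w : finite_rank w ->
  exists r (f : 'I_r -> V), [/\ lin_indep f, forall a, exists v, f a = w v
    & forall v, in_span f (w v)].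
Proof.
move=> [n [e eP]].
pose P r := `[< exists f : 'I_r -> V,
  lin_indep f /\ forall a, exists v, f a = w v >].
have P0 : exists r, P r.
  by exists 0%N; apply/asboolP; exists (fun=> 0); split=> [c _|] [].
have Pn r : P r -> (r <= n)%N.
  move=> /asboolP[f [ffree fw]]; apply: (lin_indep_leq ffree (e := e)) => a.
  by have [v ->] := fw a.
case: (ex_maxnP P0 Pn) => r /asboolP[f [ffree fw]] rmax.
exists r, f; split=> // v.
pose g (i : 'I_r.+1) := if unlift ord0 i is Some j then f j else w v.
have gE c : \sum_i c i *: g i =
    c ord0 *: w v + \sum_i c (lift ord0 i) *: f i.
  rewrite big_ord_recl /g unlift_none; congr (_ + _).
  by apply: eq_bigr => i _; rewrite liftK.
have : ~ lin_indep g.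
  move=> gfree; have /rmax : P r.+1; last by rewrite ltnn.
  apply/asboolP; exists g; split=> // i; rewrite /g.
  by case: unliftP => [j _|_]; [exact: fw|exists v].
move=> gdep; apply: contrapT => nv; apply: gdep => c.
rewrite gE => c0.
have c00 : c ord0 = 0.
  apply: contrapT => /eqP c0N; apply: nv.
  exists (fun i => - (c ord0)^-1 * c (lift ord0 i)).
  under eq_bigr do rewrite -scalerA.
  rewrite -scaler_sumr; move/eqP: c0; rewrite addrC addr_eq0 => /eqP ->.
  by rewrite scaleNr scalerN opprK scalerA mulVf // scale1r.
move=> i; case: (unliftP ord0 i) => [j ->|->//].
by move: c0; rewrite c00 scale0r add0r => /ffree.
Qed.

Lemma restricted_detP u r (f : 'I_r -> V) (psi : V -> 'I_r -> F) d :
    lin_indep f -> (forall a, exists v, f a = (u - 1) v) ->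
    (forall v, (u - 1) v = \sum_a psi v a *: f a) ->
  is_restricted_det u d ->
  d = \det (1%:M + \matrix_(a, b) psi (f a) b).
Proof.
move=> ffree fu upsi [n [e [A [efree eu eA ->]]]].
have /choice[P fP] : forall a, exists c, f a = \sum_j c j *: e j.
  by move=> a; have [v ->] := fu a; exact: eu.
pose MP := \matrix_(a, j) P a j; pose MQ := \matrix_(i, b) psi (e i) b.
have -> : A = 1%:M + MQ *m MP.
  apply/matrixP => i; apply: (lin_indep_inj efree); rewrite -eA.
  transitivity (e i + \sum_a psi (e i) a *: f a).
    by rewrite -upsi End_addE End_oppE End_oneE addrC subrK.
  under [RHS]eq_bigr do rewrite mxE scalerDl.
  rewrite big_split /=; congr (_ + _).
    rewrite (bigD1 i) //= mxE eqxx scale1r big1 ?addr0// => j ji.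
    by rewrite mxE eq_sym (negPf ji) scale0r.
  under eq_bigr => a _ do rewrite fP scaler_sumr.
  rewrite exchange_big /=; apply: eq_bigr => j _.
  rewrite mxE scaler_suml; apply: eq_bigr => a _.
  by rewrite scalerA !mxE.
rewrite det_1addM_comm; congr (\det (_ + _)).
apply/matrixP => a; apply: (lin_indep_inj ffree).
under [RHS]eq_bigr do rewrite mxE.
have usum (w : End V) c : w (\sum_j c j *: e j) = \sum_j c j *: w (e j).
  rewrite (linear_sum (w : {linear V -> V})); apply: eq_bigr => j _.
  exact: (linearZ_LR (w : {linear V -> V})).
rewrite -upsi [in RHS]fP usum.
under [RHS]eq_bigr do rewrite upsi scaler_sumr.
rewrite exchange_big /=; apply: eq_bigr => b _.
rewrite mxE scaler_suml; apply: eq_bigr => j _.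
by rewrite scalerA !mxE.
Qed.

Lemma SPf_detP u : SPf u ->
  is_restricted_det u (SPf_det u) /\
  forall d, is_restricted_det u d -> d = SPf_det u.
Proof.
move=> [_ [w wfin uE]].
have uw : u - 1 = w by rewrite uE addrC addKr.
have [r [f [ffree fw /choice[psi psiP]]]] := image_basis wfin.
rewrite -uw in fw psiP.
have detE := restricted_detP ffree fw psiP.
have ex : is_restricted_det u (\det (1%:M + \matrix_(a, b) psi (f a) b)).
  exists r, f, (1%:M + \matrix_(a, b) psi (f a) b); split=> //.
    by move=> v; exists (psi v).
  move=> a; transitivity (f a + \sum_b psi (f a) b *: f b).
    by rewrite -psiP End_addE End_oppE End_oneE addrC subrK.
  under [RHS]eq_bigr do rewrite mxE scalerDl.
  rewrite big_split /=; congr (_ + _).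
    rewrite (bigD1 a) //= mxE eqxx scale1r big1 ?addr0// => j ja.
    by rewrite mxE eq_sym (negPf ja) scale0r.
  by apply: eq_bigr => b _; rewrite mxE.
have detP : is_restricted_det u (SPf_det u).
  exact: (xgetPex 0 (P := [set d | is_restricted_det u d])
    (ex_intro _ _ ex)).
by split=> // d /detE ->; rewrite -(detE _ detP).
Qed.

End DeterminantWellDefined.

(* Main.v *)
Require Import Defs.
From HB Require Import structures.
From mathcomp Require Import all_boot all_order all_algebra all_classical.
From mathcomp Require Import zify ring.

Set Implicit Arguments.
Unset Strict Implicit.
Unset Printing Implicit Defensive.

Import GRing.Theory.
Local Open Scope ring_scope.

(** Call [N] a graded product if [N = (1 + A) (1 + B)], where [A] and [B] have
    square zero and both anticommute with an involution [s].  Such an [N] is a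
    product of two unipotent elements of index 2, and also the product of the
    two involutions [(1 + A) s] and [s (1 + B)].  So all the decompositions of
    [i u] come from one: an involution [a] and a graded product [N] with
    [i u = a N] (conjugating by [a] moves the involution to another place).

    For [u = 1], let [a] be [1] on one half of [V] and [-1] on the other: then
    [N = a i] is [i] on one half and [-i] on the other, and the matrix
    [diag(i, -i)] is a graded product.  For a general [u], one splits [V] into a
    finite-dimensional stable subspace [W] that contains the image of [u - 1]
    and a complement on which [u = 1] and which has a basis made of pairs of
    vectors (lemma [pairing_basis], by Zorn's lemma); it remains to factor the
    matrix of [i u] on a suitable [W].

    Let [D] be the matrix of [u] on the image of [u - 1], so that [det D] is the
    determinant of [u].  Adding to this image vectors whose images under [u - 1]
    are prescribed gives the matrix [[D, E; 0, 1]] with [E] almost arbitrary.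
    If [a] exchanges the two halves of the basis, then [a i u] is
    [[0, i; i D, i E]]; when [D = G T] and [E = - i (G + T)], this is similar to
    [[T, i; 0, G]] (lemma [swap_step_similar]).

    If [D] is not a scalar matrix, one makes [det D] its upper left entry, with
    a Schur complement [G T] that is a product of two unipotent matrices
    (lemmas [schur_corner] and [unipotent_factors], after Sourour).  The first
    vector is an eigenvector of [a], and [a i u] becomes block triangular with
    one eigenvalue [i det D] or [- i det D], the rest being unipotent.
    A unipotent matrix is a graded product (lemma
    [graded_product_unipotent]).  The hypothesis on the determinant says that
    the remaining eigenvalue can be chosen in [{1, i, -i}]: if it is [1]
    everything is unipotent, and otherwise a vector fixed by [u] is added to
    [W], on which [a] supplies the opposite, that is inverse, eigenvalue.

    If [D] is the scalar [x <> 1], the eigenvalues of [a i u] are essentially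
    forced: each vector of the image of [u - 1] prolongs a chain
    [i x, (i x)^-1, i x^2, (i x^2)^-1, ...], in which [p] and [p^-1] can be
    paired into a graded product, and the last link is [i det D] up to sign.
    It is enough to treat the least [q > 0] such that [x^q] is a fourth root of
    unity (lemma [scaled_fourth_period]), because the links met on the way are
    then distinct enough to split the matrix; the exception is [x^q = -1] with
    [q > 1], where a chain of Jordan blocks of size 2 is used instead. *)

(** * Graded products *)
Definition swapped (R : pzRingType) (s A : R) : Prop :=
  A * A = 0 /\ s * A = - (A * s).

(** When 2 is invertible, [s] splits the module into two eigenspaces that [A]
    and [B] exchange; in matrix form, [1 + A] and [1 + B] are off-diagonally
    perturbed identities.  Remembering [s] is what makes one and the same
    factorization yield two unipotent elements and two involutions. *)
Definition graded_product (R : pzRingType) (N : R) : Prop :=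
  exists s A B : R,
    [/\ s * s = 1, swapped s A, swapped s B & N = (1 + A) * (1 + B)].

Definition inv_graded_product (R : pzRingType) (M : R) : Prop :=
  exists a N : R, [/\ a * a = 1, graded_product N & M = a * N].

Lemma three_factors (R : pzRingType) (M : R) : inv_graded_product M ->
  [/\ exists a b c : R,
        [/\ is_involution a, is_involution b, is_involution c & M = a * b * c],
      exists a b c : R,
        [/\ is_involution a, is_unipotent2 b, is_unipotent2 c & M = a * b * c],
      exists a b c : R,
        [/\ is_unipotent2 a, is_involution b, is_unipotent2 c & M = a * b * c]
    & exists a b c : R,
        [/\ is_unipotent2 a, is_unipotent2 b, is_involution c
          & M = a * b * c]].
Proof.
move=> [a [_ [aa [s [A [B [ss [AA sA] [BB sB] ->]]]] ->]]].
have unip2 (X : R) : X * X = 0 -> is_unipotent2 (1 + X).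
  by move=> XX; rewrite /is_unipotent2 addrC addKr expr2.
have conj1 (X : R) : a * (1 + X) * a = 1 + a * X * a.
  by rewrite mulrDr mulr1 mulrDl aa.
have conj0 (X : R) : X * X = 0 -> is_unipotent2 (a * (1 + X) * a).
  move=> XX; rewrite conj1; apply: unip2.
  by rewrite -!mulrA (mulrA a a) aa mul1r (mulrA X X) XX mul0r mulr0.
have sM (X : R) : s * X = - (X * s) -> s * (1 + X) = (1 - X) * s.
  by move=> sX; rewrite mulrDr mulr1 sX mulrBl mul1r.
have sqD (X : R) : X * X = 0 -> (1 + X) * (1 - X) = 1.
  by move=> XX; rewrite mulrDl mul1r mulrBr mulr1 XX subr0 subrK.
have sqB (X : R) : X * X = 0 -> (1 - X) * (1 + X) = 1.
  by move=> XX; rewrite mulrBl mul1r mulrDr mulr1 XX addr0 addrK.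
have cancela (X : R) : X * a * a = X by rewrite -mulrA aa mulr1.
split.
- exists a, ((1 + A) * s), (s * (1 + B)); split; rewrite /is_involution ?expr2//.
  + by rewrite mulrA -(mulrA (1 + A)) sM// !mulrA sqD// mul1r.
  + by rewrite mulrA sM// -(mulrA _ s s) ss mulr1 sqB.
  + by rewrite -!mulrA (mulrA s s) ss mul1r.
- by exists a, (1 + A), (1 + B); split; [|exact: unip2|exact: unip2|rewrite mulrA].
- exists (a * (1 + A) * a), a, (1 + B); split=> //; first exact: conj0.
    exact: unip2.
  by rewrite cancela mulrA.
- exists (a * (1 + A) * a), (a * (1 + B) * a), a.
  by split=> //; [exact: conj0|exact: conj0|rewrite !mulrA !cancela].
Qed.

Section Transport.
Variables (R S T : pzRingType) (f : R -> S -> T).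
Hypothesis f1 : f 1 1 = 1.
Hypothesis fM : forall x x' y y', f (x * x') (y * y') = f x y * f x' y'.
Hypothesis fD : forall x x' y y', f (x + x') (y + y') = f x y + f x' y'.

Lemma transport0 : f 0 0 = 0.
Proof. by apply: (addrI (f 0 0)); rewrite -fD !addr0. Qed.

Lemma transportN x y : f (- x) (- y) = - f x y.
Proof.
by apply: (addrI (f x y)); rewrite -fD !subrr transport0.
Qed.

(** A ring morphism in two arguments covers at once conjugation, block sums and
    the action of a pair of matrices on an infinite-dimensional space. *)
Lemma graded_product_map2 x y :
  graded_product x -> graded_product y -> graded_product (f x y).
Proof.
move=> [s [A [B [ss [AA sA] [BB sB] ->]]]].
move=> [s' [A' [B' [ss' [AA' sA'] [BB' sB'] ->]]]].
exists (f s s'), (f A A'), (f B B'); split.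
- by rewrite -fM ss ss'.
- by split; rewrite -!fM ?AA ?AA' ?transport0// sA sA' transportN.
- by split; rewrite -!fM ?BB ?BB' ?transport0// sB sB' transportN.
- by rewrite fM !fD f1.
Qed.

Lemma inv_graded_product_map2 x y :
  inv_graded_product x -> inv_graded_product y -> inv_graded_product (f x y).
Proof.
move=> [a [N [aa gN ->]]] [a' [N' [aa' gN' ->]]].
exists (f a a'), (f N N'); split; [|exact: graded_product_map2|exact: fM].
by rewrite -fM aa aa' f1.
Qed.

End Transport.

(** * Similarity and block sums *)
Section Matrices.
Variable F : fieldType.

(** Matrices of a priori different sizes are allowed, so that rearranging
    blocks needs no cast between sizes that are only provably equal. *)
Definition mxsim m n (A : 'M[F]_m) (B : 'M[F]_n) : Prop :=
  exists (P : 'M[F]_(m, n)) (Q : 'M[F]_(n, m)),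
    [/\ P *m Q = 1%:M, Q *m P = 1%:M & A *m P = P *m B].

Definition dsum m n (A : 'M[F]_m) (B : 'M[F]_n) : 'M[F]_(m + n) :=
  block_mx A 0 0 B.

Lemma mxsim_refl m (A : 'M[F]_m) : mxsim A A.
Proof. by exists 1%:M, 1%:M; rewrite !mulmx1 mul1mx. Qed.

Lemma mxsim_sym m n (A : 'M[F]_m) (B : 'M[F]_n) : mxsim A B -> mxsim B A.
Proof.
move=> [P [Q [PQ QP AP]]]; exists Q, P; split=> //.
by rewrite -[RHS]mulmx1 -PQ mulmxA -(mulmxA Q A) AP mulmxA QP mul1mx.
Qed.

Lemma mxsim_trans m n p (B : 'M[F]_n) (A : 'M[F]_m) (C : 'M[F]_p) :
  mxsim A B -> mxsim B C -> mxsim A C.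
Proof.
move=> [P [Q [PQ QP AP]]] [P' [Q' [PQ' QP' BP]]].
exists (P *m P'), (Q' *m Q); split.
- by rewrite mulmxA -(mulmxA P) PQ' mulmx1.
- by rewrite mulmxA -(mulmxA Q') QP mulmx1.
- by rewrite mulmxA AP -mulmxA BP mulmxA.
Qed.

Lemma mxsimE m n (A : 'M[F]_m) (B : 'M[F]_n) (P : 'M_(m, n)) Q :
  P *m Q = 1%:M -> A *m P = P *m B -> A = P *m B *m Q.
Proof. by move=> PQ <-; rewrite -mulmxA PQ mulmx1. Qed.

Lemma mxsim_conj n (P A : 'M[F]_n) :
  P \in unitmx -> mxsim (P *m A *m invmx P) A.
Proof.
by move=> Pu; exists P, (invmx P); rewrite mulmxV// mulVmx// mulmxKV.
Qed.

Lemma mxsim_scale a m n (A : 'M[F]_m) (B : 'M[F]_n) :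
  mxsim A B -> mxsim (a *: A) (a *: B).
Proof.
by move=> [P [Q [PQ QP AP]]]; exists P, Q; split; rewrite // -scalemxAl AP scalemxAr.
Qed.

Lemma dsum1 m n : dsum 1%:M 1%:M = 1%:M :> 'M[F]_(m + n).
Proof. by rewrite /dsum -scalar_mx_block. Qed.

Lemma dsumM m n (A A' : 'M[F]_m) (B B' : 'M[F]_n) :
  dsum (A *m A') (B *m B') = dsum A B *m dsum A' B'.
Proof. by rewrite /dsum mulmx_block !(mul0mx, mulmx0) !addr0 add0r. Qed.

Lemma dsumD m n (A A' : 'M[F]_m) (B B' : 'M[F]_n) :
  dsum (A + A') (B + B') = dsum A B + dsum A' B'.
Proof. by rewrite /dsum add_block_mx !addr0. Qed.

Lemma dsumZ a m n (A : 'M[F]_m) (B : 'M[F]_n) :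
  a *: dsum A B = dsum (a *: A) (a *: B).
Proof. by rewrite /dsum scale_block_mx !scaler0. Qed.

Lemma dsum_similar m n m' n' (A : 'M[F]_m) (B : 'M[F]_n) (A' : 'M[F]_m')
    (B' : 'M[F]_n') :
  mxsim A A' -> mxsim B B' -> mxsim (dsum A B) (dsum A' B').
Proof.
move=> [P [Q [PQ QP AP]]] [P' [Q' [PQ' QP' BP']]].
exists (block_mx P 0 0 P'), (block_mx Q 0 0 Q').
rewrite !mulmx_block !(mul0mx, mulmx0) !addr0 !add0r.
by rewrite PQ QP PQ' QP' AP BP' -!scalar_mx_block.
Qed.

Lemma dsumC_similar m n (A : 'M[F]_m) (B : 'M[F]_n) :
  mxsim (dsum A B) (dsum B A).
Proof.
exists (block_mx 0 1%:M 1%:M 0), (block_mx 0 1%:M 1%:M 0).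
rewrite !mulmx_block !(mul0mx, mulmx0, mul1mx, mulmx1) !addr0 !add0r.
by rewrite -!scalar_mx_block.
Qed.

Lemma mxsim_cast m n (e : m = n) (A : 'M[F]_m) :
  mxsim A (castmx (e, e) A).
Proof. by case: n / e; rewrite castmx_id; exact: mxsim_refl. Qed.

Lemma dsumA_similar m n p (A : 'M[F]_m) (B : 'M[F]_n) (C : 'M[F]_p) :
  mxsim (dsum A (dsum B C)) (dsum (dsum A B) C).
Proof.
apply: mxsim_sym; have := @block_mxA _ m n p m n p A 0 0 0 B 0 0 0 C.
rewrite !row_mx0 !col_mx0 /dsum /= => ->; exact: mxsim_cast.
Qed.

End Matrices.

(** * Unipotent matrices *)
Section MatrixFactors.
Variable F : fieldType.

Lemma graded_product_similar m n (A : 'M[F]_m) (B : 'M[F]_n) :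
  mxsim A B -> graded_product B -> graded_product A.
Proof.
move=> [P [Q [PQ QP AP]]] gB; rewrite (mxsimE PQ AP).
pose f (X _ : 'M[F]_n) : 'M[F]_m := P *m X *m Q.
apply: (@graded_product_map2 _ _ _ f _ _ _ B B) => //=.
- by rewrite /f mulmx1.
- move=> x x' y y'; rewrite /f -!mulmxE !mulmxA.
  by rewrite -(mulmxA _ Q P) QP mulmx1.
- by move=> x x' y y'; rewrite /f mulmxDr mulmxDl.
Qed.

Lemma graded_product_dsum m n (A : 'M[F]_m) (B : 'M[F]_n) :
  graded_product A -> graded_product B -> graded_product (dsum A B).
Proof.
apply: (@graded_product_map2 _ _ _ (@dsum F m n)).
- exact: dsum1.
- by move=> *; rewrite -!mulmxE dsumM.
- by move=> *; rewrite dsumD.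
Qed.

Lemma inv_graded_product_similar m n (A : 'M[F]_m) (B : 'M[F]_n) :
  mxsim A B -> inv_graded_product B -> inv_graded_product A.
Proof.
move=> [P [Q [PQ QP AP]]] gB; rewrite (mxsimE PQ AP).
pose f (X _ : 'M[F]_n) : 'M[F]_m := P *m X *m Q.
apply: (@inv_graded_product_map2 _ _ _ f _ _ _ B B) => //=.
- by rewrite /f mulmx1.
- move=> x x' y y'; rewrite /f -!mulmxE !mulmxA.
  by rewrite -(mulmxA _ Q P) QP mulmx1.
- by move=> x x' y y'; rewrite /f mulmxDr mulmxDl.
Qed.

Lemma inv_graded_product_dsum m n (A : 'M[F]_m) (B : 'M[F]_n) :
  inv_graded_product A -> inv_graded_product B ->
  inv_graded_product (dsum A B).
Proof.
apply: (@inv_graded_product_map2 _ _ _ (@dsum F m n)).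
- exact: dsum1.
- by move=> *; rewrite -!mulmxE dsumM.
- by move=> *; rewrite dsumD.
Qed.

Lemma graded_product1 n : graded_product (1%:M : 'M[F]_n).
Proof.
exists 1, 0, 0; rewrite /swapped !(mulr0, mul0r) oppr0 mulr1 addr0.
by split; rewrite ?mulr1.
Qed.

Definition nilp n (X : 'M[F]_n) : Prop := exists k, X ^+ k = 0.

Lemma nilp0 n : nilp (0 : 'M[F]_n).
Proof. by exists 1%N; rewrite expr1. Qed.

Lemma nilp_similar m n (A : 'M[F]_m) (B : 'M[F]_n) :
  mxsim A B -> nilp B -> nilp A.
Proof.
move=> [P [Q [PQ QP AP]]] [k Bk]; exists k.
have AkP : A ^+ k *m P = P *m B ^+ k.
  elim: k {Bk} => [|k IH]; first by rewrite !expr0 mul1mx mulmx1.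
  by rewrite !exprSr -!mulmxE -mulmxA AP mulmxA IH mulmxA.
by rewrite (mxsimE PQ AkP) Bk mulmx0 mul0mx.
Qed.

Lemma nilp_block m n (A : 'M[F]_m) (B : 'M[F]_(m, n)) (C : 'M[F]_n) :
  nilp A -> nilp C -> nilp (block_mx A B 0 C).
Proof.
move=> [k Ak] [l Cl].
have XE j : exists Y, block_mx A B 0 C ^+ j = block_mx (A ^+ j) Y 0 (C ^+ j).
  elim: j => [|j [Y IH]]; first by exists 0; exact: scalar_mx_block.
  exists (A *m Y + B *m C ^+ j); rewrite !exprS IH -!mulmxE mulmx_block.
  by rewrite !(mulmx0, mul0mx) !addr0 add0r.
have [Y Xk] := XE k; have [Z Xl] := XE l.
exists (k + l)%N; rewrite exprD Xk Xl Ak Cl -mulmxE mulmx_block.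
by rewrite !(mulmx0, mul0mx) !addr0 block_mx0.
Qed.

Lemma nilp_lblock m n (A : 'M[F]_m) (B : 'M[F]_(n, m)) (C : 'M[F]_n) :
  nilp A -> nilp C -> nilp (block_mx A 0 B C).
Proof.
move=> nA nC; apply: nilp_similar (nilp_block B nC nA).
exists (block_mx 0 1%:M 1%:M 0), (block_mx 0 1%:M 1%:M 0).
rewrite !mulmx_block !(mul0mx, mulmx0, mul1mx, mulmx1) !addr0 !add0r.
by rewrite -!scalar_mx_block.
Qed.

(** A nilpotent matrix has no nonzero eigenvalue. *)
Lemma nilp_unit n (X : 'M[F]_n) (c : F) :
  nilp X -> c != 0 -> c%:M + X \in unitmx.
Proof.
move=> [k Xk] c0; rewrite -row_free_unit; apply: inj_row_free => v.
rewrite mulmxDr mul_mx_scalar => /eqP; rewrite addrC addr_eq0 => /eqP vX.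
have vXj j : v *m X ^+ j = (- c) ^+ j *: v.
  elim: j => [|j IH]; first by rewrite !expr0 mulmx1 scale1r.
  rewrite exprSr -mulmxE mulmxA IH -scalemxAl vX -scaleNr scalerA.
  by rewrite -exprSr.
have := vXj k; rewrite Xk mulmx0 => /esym/eqP; rewrite scaler_eq0.
by rewrite expf_eq0 oppr_eq0 (negPf c0) andbF => /eqP.
Qed.

(** A complement can be chosen so as to contain any subspace that is disjoint
    from the one to be complemented. *)
Lemma compl_exists n (A B H : 'M[F]_n) :
  (A <= H)%MS -> (B <= H)%MS -> (A :&: B)%MS = 0 ->
  exists C : 'M[F]_n,
    [/\ (B <= C)%MS, (C <= H)%MS, (A :&: C)%MS = 0 & (H <= A + C)%MS].
Proof.
move=> AH BH AB; pose D := (H :\: (A + B))%MS; exists (B + D)%MS.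
have DH : (D <= H)%MS by exact: diffmxSl.
have ABH : (A + B <= H)%MS by rewrite addsmx_sub AH.
have HE : (A + B + D :=: H)%MS.
  have HI : (H :&: (A + B) :=: A + B)%MS by apply/capmx_idPr.
  rewrite addsmxC; apply: eqmx_trans (addsmx_diff_cap_eq H (A + B)%MS).
  by apply: adds_eqmx => //; exact: eqmx_sym.
split.
- exact: addsmxSl.
- by rewrite addsmx_sub BH.
- have ABD : ((A + B) :&: D)%MS = 0.
    by rewrite capmxC capmx_diff.
  apply/eqP; rewrite -mxrank_eq0; apply/eqP.
  have := mxrank_sum_cap A (B + D)%MS; have := mxrank_sum_cap A B.
  have := mxrank_sum_cap (A + B)%MS D; have := mxrank_adds_leqif B D.
  by rewrite addsmxA ABD AB !mxrank0 => -[+ _]; lia.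
- by rewrite addsmxA HE.
Qed.

End MatrixFactors.

(** The algebra behind the construction: it only remains to find two
    complementary subspaces that [X] and [X N^-1] alternately exchange. *)
Lemma graded_product_proj (R : pzRingType) (p q X Y : R) :
    p + q = 1 -> p * p = p -> q * q = q -> p * q = 0 -> q * p = 0 ->
    p * Y * p = 0 -> p * Y * q = p * Y -> q * X * q = 0 -> q * X * p = q * X ->
    Y * (1 + X) = X ->
  graded_product (1 + X).
Proof.
move=> pq1 pp qq pq qp pYp pYq qXq qXp YX.
exists (p - q), (p * Y), (q * X); split.
- by rewrite mulrBl !mulrBr pp qq pq qp subr0 sub0r opprK.
- split; first by rewrite mulrA pYp mul0r.
  by rewrite mulrBl !mulrA pp qp mul0r subr0 mulrBr pYp pYq sub0r opprK.
- split; first by rewrite mulrA qXq mul0r.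
  by rewrite mulrBl !mulrA qq pq mul0r sub0r mulrBr qXp qXq subr0.
have pYN : p * Y + p * Y * X = p * X.
  by rewrite -[in RHS]YX mulrDr mulr1 mulrDr mulrA.
rewrite mulrDl mul1r mulrDr mulr1 mulrA pYq pYN -addrA -mulrDl.
by rewrite (addrC q) pq1 mul1r.
Qed.

Section Unipotent.
Variable F : fieldType.

Lemma sub_kermx_coker m n (W : 'M[F]_(m, n)) (X A : 'M[F]_n) :
  (W <= kermx (X *m cokermx A))%MS = (W *m X <= A)%MS.
Proof. by rewrite sub_kermx mulmxA -submxE. Qed.

(** The row spaces of [V1] and [V2] grade that of [H], and are exchanged by [X]
    in one direction and by [Y] in the other. *)
Definition alternating n (X Y H V1 V2 : 'M[F]_n) : Prop :=
  [/\ (V1 + V2 :=: H)%MS, (V1 :&: V2)%MS = 0,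
      (V2 *m X <= V1)%MS & (V1 *m Y <= V2)%MS].

(** From a grading [A1 + A2] of the image of [X ^+ k.+1] one gets [V1] and [V2]
    as large enough parts of the preimages, in the image of [X ^+ k], of [A2]
    under [X N^-1] and of [A1] under [X].  These preimages span: if [v X] splits
    as [a1 + a2], lift [a2] to [w X]; then [v - w] is in the second preimage,
    and [w = w N - w X], where [w N] is in the first preimage and
    [w X = a2] is in the second one. *)
Lemma alternating_step n (X N : 'M[F]_n) k : N = 1%:M + X -> N \in unitmx ->
  (exists V1 V2, alternating X (X *m invmx N) (X ^+ k.+1) V1 V2) ->
  exists V1 V2, alternating X (X *m invmx N) (X ^+ k) V1 V2.
Proof.
move=> NE Nu; set Y := X *m invmx N; set H : 'M_n := X ^+ k.
move=> [A1 [A2 [A12 A0 A2X A1Y]]].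
have XkS : X ^+ k.+1 = H *m X by rewrite exprSr.
have comX : H *m X = X *m H by rewrite -XkS exprS.
have NX : N *m X = X *m N by rewrite NE mulmxDl mulmxDr mul1mx mulmx1.
have AH : (A1 + A2 <= H)%MS by rewrite A12 XkS comX submxMl.
have [A1H A2H] : (A1 <= H)%MS /\ (A2 <= H)%MS.
  by move: AH; rewrite addsmx_sub => /andP.
pose H1 := (H :&: kermx (Y *m cokermx A2))%MS.
pose H2 := (H :&: kermx (X *m cokermx A1))%MS.
have H1P m (W : 'M_(m, n)) : (W <= H1)%MS = (W <= H)%MS && (W *m Y <= A2)%MS.
  by rewrite sub_capmx sub_kermx_coker.
have H2P m (W : 'M_(m, n)) : (W <= H2)%MS = (W <= H)%MS && (W *m X <= A1)%MS.
  by rewrite sub_capmx sub_kermx_coker.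
have A1H1 : (A1 <= H1)%MS by rewrite H1P A1H.
have A2H2 : (A2 <= H2)%MS by rewrite H2P A2H.
have HH : (H <= H1 + H2)%MS.
  have HXA : (H *m X <= A2 + A1)%MS by rewrite addsmxC A12 XkS.
  pose a2 := H *m X *m proj_mx A2 A1.
  have a2A : (a2 <= A2)%MS by exact: proj_mx_sub.
  have a1A : (H *m X - a2 <= A1)%MS by exact: proj_mx_compl_sub.
  have /submxP[W a2E] : (a2 <= H *m X)%MS.
    by rewrite -XkS -A12 (submx_trans a2A) ?addsmxSr.
  rewrite mulmxA in a2E; set v := W *m H in a2E.
  have vH : (v <= H)%MS by exact: submxMl.
  have -> : H = v *m N + (- (v *m X) + (H - v)).
    by rewrite NE mulmxDr mulmx1 addrA addrK addrC subrK.
  apply: addmx_sub_adds.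
    rewrite H1P /Y mulmxA -(mulmxA v N) NX mulmxA mulmxK// -a2E a2A andbT.
    rewrite NE mulmxDr mulmx1 addmx_sub//.
    by rewrite -a2E (submx_trans a2A).
  apply: addmx_sub; first by rewrite eqmx_opp -a2E (submx_trans a2A).
  by rewrite H2P mulmxBl -a2E a1A andbT addmx_sub// eqmx_opp.
(* [V1] is a complement of [A2] in the first preimage, [V2] a complement of
   [V1] in the second one. *)
have A1A2H1 : (A2 :&: H1 :&: A1)%MS = 0.
  apply/eqP; rewrite -submx0 -A0 sub_capmx capmxSr.
  by rewrite (submx_trans (capmxSl _ _)) ?capmxSl.
have [V1 [A1V1 V1H1 V1A2 H1V1]] := compl_exists (capmxSr A2 H1) A1H1 A1A2H1.
have V1A2' : ((V1 :&: H2) :&: A2)%MS = 0.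
  apply/eqP; rewrite -submx0 -V1A2.
  have VV : (V1 :&: H2 :&: A2 <= V1)%MS.
    by rewrite (submx_trans (capmxSl _ _)) ?capmxSl.
  by rewrite sub_capmx VV andbT sub_capmx capmxSr (submx_trans VV).
have [V2 [A2V2 V2H2 V2V1 H2V2]] := compl_exists (capmxSr V1 H2) A2H2 V1A2'.
exists V1, V2; split.
- apply/eqmxP; rewrite addsmx_sub (submx_trans V1H1) ?capmxSl//=.
  rewrite (submx_trans V2H2) ?capmxSl//= (submx_trans HH)//.
  rewrite addsmx_sub (submx_trans H1V1)/=.
    by rewrite (submx_trans H2V2)// addsmxS// capmxSl.
  rewrite addsmx_sub addsmxSl andbT (submx_trans (capmxSl _ _))//.
  by rewrite (submx_trans A2V2) ?addsmxSr.
- apply/eqP; rewrite -submx0 -V2V1 sub_capmx capmxSr andbT sub_capmx capmxSl.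
  by rewrite (submx_trans (capmxSr _ _)).
- by move: V2H2; rewrite H2P => /andP[_ /submx_trans->].
- by move: V1H1; rewrite H1P => /andP[_ /submx_trans->].
Qed.

(** Descending induction from [X ^+ k = 0] to [X ^+ 0 = 1] grades the whole
    space; no Jordan form is needed. *)
Lemma graded_product_unipotent n (X : 'M[F]_n) :
  nilp X -> graded_product (1%:M + X).
Proof.
move=> nX; set N := 1%:M + X.
have Nu : N \in unitmx by apply: nilp_unit; rewrite ?oner_eq0.
have [V1 [V2]] : exists V1 V2, alternating X (X *m invmx N) (X ^+ 0) V1 V2.
  case: nX => k Xk.
  have : exists V1 V2, alternating X (X *m invmx N) (X ^+ k) V1 V2.
    exists 0, 0; rewrite Xk; split; rewrite ?mul0mx ?sub0mx ?cap0mx//.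
    exact: addsmx0.
  by elim: k {Xk} => // k IH /(alternating_step erefl Nu).
set Y := X *m invmx N; rewrite expr0 => -[V12 V0 V2X V1Y].
have V21 : (V2 :&: V1)%MS = 0 by rewrite capmxC.
pose p := proj_mx V1 V2; pose q := proj_mx V2 V1.
have p1 : (p <= V1)%MS by have := proj_mx_sub V1 V2 1%:M; rewrite mul1mx.
have q2 : (q <= V2)%MS by have := proj_mx_sub V2 V1 1%:M; rewrite mul1mx.
have pq1 : p + q = 1%:M.
  by have := @add_proj_mx _ _ _ V1 V2 1%:M V0; rewrite !mul1mx V12; apply.
have [pp qq] : p *m p = p /\ q *m q = q by split; rewrite proj_mx_id.
have [pq qp] : p *m q = 0 /\ q *m p = 0 by split; rewrite proj_mx_0.
have pYV : (p *m Y <= V2)%MS by rewrite (submx_trans _ V1Y)// submxMr.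
have qXV : (q *m X <= V1)%MS by rewrite (submx_trans _ V2X)// submxMr.
have [pYp pYq] : p *m Y *m p = 0 /\ p *m Y *m q = p *m Y.
  by rewrite proj_mx_0 ?proj_mx_id.
have [qXq qXp] : q *m X *m q = 0 /\ q *m X *m p = q *m X.
  by rewrite proj_mx_0 ?proj_mx_id.
apply: (@graded_product_proj _ p q X Y) => //.
by rewrite /Y -mulmxE mulmxKV.
Qed.

End Unipotent.

(** * Exchanging two summands *)
Section Bricks.
Variables (F : fieldType) (i : F).
Hypothesis ii : i * i = -1.

(** The hypothesis is the Sylvester equation that a block-diagonalizing shear
    has to solve. *)
Lemma split_ublock m n (A : 'M[F]_m) B (C : 'M[F]_n) (Z : 'M_(m, n)) :
  A *m Z + B = Z *m C -> mxsim (block_mx A B 0 C) (dsum A C).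
Proof.
move=> AZ; exists (block_mx 1%:M Z 0 1%:M), (block_mx 1%:M (- Z) 0 1%:M).
rewrite !mulmx_block !(mul0mx, mulmx0, mul1mx, mulmx1, addr0, add0r).
by rewrite AZ addNr addrN -scalar_mx_block.
Qed.

Lemma split_lblock m n (A : 'M[F]_m) B (C : 'M[F]_n) (Z : 'M_(n, m)) :
  B + C *m Z = Z *m A -> mxsim (block_mx A 0 B C) (dsum A C).
Proof.
move=> AZ; exists (block_mx 1%:M 0 Z 1%:M), (block_mx 1%:M 0 (- Z) 1%:M).
rewrite !mulmx_block !(mul0mx, mulmx0, mul1mx, mulmx1, addr0, add0r).
by rewrite AZ addNr addrN -scalar_mx_block.
Qed.

(** This is [i] times the product of the exchange of the two summands with
    [[D, - i C; 0, 1]] (lemma [brick_swap]); its eigenvalues are the zeros of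
    [det (t^2 - t C + D)]. *)
Definition swap_step n (D C : 'M[F]_n) : 'M[F]_(n + n) :=
  block_mx 0 i%:M (i *: D) C.

Lemma shear_inv n (A : 'M[F]_n) :
  block_mx 1%:M 0 A 1%:M *m block_mx 1%:M 0 (- A) 1%:M = 1%:M.
Proof.
rewrite mulmx_block !(mul0mx, mulmx0, mul1mx, mulmx1, addr0, add0r) addrN.
by rewrite -scalar_mx_block.
Qed.

(** [t^2 - t (G + T) + G T = (t - G) (t - T)]: hence the block-triangular
    form. *)
Lemma swap_step_shear n (G T : 'M[F]_n) (S := block_mx 1%:M 0 (- (i *: T)) 1%:M) :
  swap_step (G *m T) (G + T) *m S = S *m block_mx T i%:M 0 G.
Proof.
rewrite /swap_step /S !mulmx_block.
rewrite !(mul0mx, mulmx0, mul1mx, mulmx1, addr0, add0r).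
congr block_mx.
- by rewrite mul_scalar_mx scalerN scalerA ii scaleN1r opprK.
- by rewrite mulmxN -scalemxAr mulmxDl scalerDr opprD addrA subrr sub0r mulNmx
    -scalemxAl.
- by rewrite mulNmx mul_mx_scalar scalerA ii scaleN1r opprK addrC.
Qed.

Lemma swap_step_similar n (G T : 'M[F]_n) :
  mxsim (swap_step (G *m T) (G + T)) (block_mx T i%:M 0 G).
Proof.
exists (block_mx 1%:M 0 (- (i *: T)) 1%:M), (block_mx 1%:M 0 (i *: T) 1%:M).
split; last exact: swap_step_shear.
  by rewrite -[X in _ *m block_mx _ _ X _]opprK shear_inv.
exact: shear_inv.
Qed.

(** In the basis [(p, i q - p)], the matrix is [[1, X; 1, 1 + X]] with
    [X = C - 2], the product of [[1, 0; 1, 1]] and [[1, X; 0, 1]]. *)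
Lemma swap_step1_graded n (C : 'M[F]_n) : graded_product (swap_step 1%:M C).
Proof.
pose X := C - 2%:M.
pose A : 'M[F]_(n + n) := block_mx 0 0 1%:M 0.
pose B : 'M[F]_(n + n) := block_mx 0 X 0 0.
pose s : 'M[F]_(n + n) := block_mx 1%:M 0 0 (- 1%:M).
have gAB : graded_product ((1 + A) * (1 + B)).
  exists s, A, B; rewrite /swapped -!mulmxE !mulmx_block.
  rewrite !(mul0mx, mulmx0, mul1mx, mulmx1, mulNmx, mulmxN, addr0, add0r).
  rewrite !(oppr0, opprK, block_mx0) -scalar_mx_block !opp_block_mx.
  by rewrite !(oppr0, opprK).
apply: graded_product_similar gAB.
exists (block_mx 1%:M (- 1%:M) 0 i%:M), (block_mx 1%:M (- i%:M) 0 (- i%:M)).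
have -> : (1 + A) * (1 + B) = block_mx 1%:M X 1%:M (1%:M + X).
  have -> : 1 = block_mx 1%:M 0 0 1%:M :> 'M[F]_(n + n) by exact: scalar_mx_block.
  rewrite -!mulmxE !add_block_mx mulmx_block.
  by rewrite !(mul0mx, mulmx0, mul1mx, mulmx1, addr0, add0r) addrC.
rewrite /swap_step !mulmx_block.
rewrite !(mul0mx, mulmx0, mul1mx, mulmx1, mulNmx, mulmxN, addr0, add0r).
rewrite !(opprK, mul_scalar_mx, mul_mx_scalar) !scalemx1 !scale_scalar_mx.
have m1 : (-1)%:M = - 1%:M :> 'M[F]_n by rewrite raddfN.
have X1 : 1%:M + X = C - 1%:M.
  by rewrite /X -[2]/(1 + 1) raddfD /= addrCA opprD [1%:M + _]addrA subrr sub0r.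
rewrite !ii m1 opprK !addNr !addrN -scalar_mx_block; split=> //.
rewrite opprD addrCA subrr addr0; congr block_mx.
by rewrite X1 scalerBr scalemx1 addrC.
Qed.

Lemma mulmx_inv_comm n (A B : 'M[F]_n) :
  A \in unitmx -> A *m B = B *m A -> invmx A *m B = B *m invmx A.
Proof. by move=> Au AB; rewrite -[LHS](mulmxK Au) -(mulmxA _ B) -AB mulKmx. Qed.

(** [P^-1] and [x P] commute and have product [x], so they are the two roots of
    [t^2 - t C + x]; they can be separated if their difference is
    invertible. *)
Lemma swap_step_split n (x : F) (P : 'M[F]_n) :
    P \in unitmx -> invmx P - x *: P \in unitmx ->
  mxsim (swap_step x%:M (invmx P + x *: P)) (dsum (x *: P) (invmx P)).
Proof.
move=> Pu; set T := x *: P; set G := invmx P => Gu.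
have -> : x%:M = G *m T by rewrite -scalemxAr mulVmx// scalemx1.
apply: mxsim_trans (swap_step_similar G T) _.
apply: (split_ublock (Z := i *: invmx (G - T))).
have TC : (G - T) *m T = T *m (G - T).
  have GT : G *m T = T *m G.
    by rewrite -scalemxAr -scalemxAl mulVmx// mulmxV.
  by rewrite mulmxBl mulmxBr GT.
have -> : T *m (i *: invmx (G - T)) = (i *: invmx (G - T)) *m T.
  have := congr1 ( *:%R i) (mulmx_inv_comm Gu TC).
  by rewrite (scalemxAl i (invmx _)) (scalemxAr i T) => /esym.
have -> : i%:M = (i *: invmx (G - T)) *m (G - T).
  by rewrite -scalemxAl mulVmx// scalemx1.
by rewrite -mulmxDr [T + _]addrC subrK.
Qed.

Lemma inverse_pair_graded n (P : 'M[F]_n) :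
    P \in unitmx -> invmx P - P \in unitmx ->
  graded_product (dsum P (invmx P)).
Proof.
move=> Pu Gu; have := @swap_step_split n 1 P Pu; rewrite scale1r => /(_ Gu).
move=> /mxsim_sym /graded_product_similar; apply.
exact: swap_step1_graded.
Qed.

End Bricks.

(** * Chains of eigenvalues *)
Section Chains.
Variables (F : fieldType) (i : F).
Hypothesis ii : i * i = -1.

Lemma dsum_interchange m n p q (A : 'M[F]_m) (B : 'M[F]_n) (C : 'M[F]_p)
    (D : 'M[F]_q) :
  mxsim (dsum (dsum A B) (dsum C D)) (dsum (dsum A C) (dsum B D)).
Proof.
apply: mxsim_trans (mxsim_sym (dsumA_similar _ _ _)) _.
apply: mxsim_trans (dsumA_similar _ _ _).
apply: dsum_similar; first exact: mxsim_refl.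
apply: mxsim_trans (dsumA_similar _ _ _) _.
apply: mxsim_trans (mxsim_sym (dsumA_similar _ _ _)).
by apply: dsum_similar; [exact: dsumC_similar|exact: mxsim_refl].
Qed.

Lemma dsum_empty_similar m (A : 'M[F]_m) (B : 'M[F]_0) : mxsim A (dsum A B).
Proof.
exists (row_mx 1%:M 0), (col_mx 1%:M 0).
rewrite mul_row_col mul_col_row !(mulmx0, mul0mx, mulmx1) addr0.
rewrite mul_mx_row mul_row_block !(mulmx0, mul0mx, mulmx1, mul1mx) !addr0.
split=> //; rewrite [in RHS]scalar_mx_block; congr block_mx.
by apply/matrixP => -[].
Qed.

Lemma dsum_scalar m n (x : F) :
  dsum (x%:M : 'M_m) (x%:M : 'M_n) = x%:M :> 'M[F]_(m + n).
Proof. by rewrite /dsum -scalar_mx_block. Qed.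

(** With [r] vectors on which [u] is the scalar [x], and some on which it is
    [1], one can reach a graded product up to a leftover block [P]. *)
Definition chain (x : F) r s (P : 'M[F]_s) : Prop :=
  exists k n (U a : 'M[F]_n) n' (Y : 'M[F]_n'),
    [/\ mxsim U (dsum (x%:M : 'M_r) (1%:M : 'M_k)), a *m a = 1%:M,
        graded_product Y & mxsim (i *: (a *m U)) (dsum Y P)].

(** The goal for a scalar [D]: some [k] fixed vectors suffice. *)
Definition scaled (x : F) r : Prop :=
  exists k, inv_graded_product (i *: dsum (x%:M : 'M_r) (1%:M : 'M_k)).

Lemma chain_similar x r s s' (P : 'M[F]_s) (P' : 'M[F]_s') :
  mxsim P P' -> chain x r P -> chain x r P'.
Proof.
move=> PP' [k [n [U [a [n' [Y [Us aa gY NY]]]]]]].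
exists k, n, U, a, n', Y; split=> //; apply: mxsim_trans NY _.
by apply: dsum_similar => //; exact: mxsim_refl.
Qed.

Lemma chain_close x r s (P : 'M[F]_s) :
  graded_product P -> chain x r P -> scaled x r.
Proof.
move=> gP [k [n [U [a [n' [Y [Us aa gY NY]]]]]]]; exists k.
apply: inv_graded_product_similar (mxsim_scale i (mxsim_sym Us)) _.
exists a, (i *: (a *m U)); split=> //.
- by apply: graded_product_similar NY _; exact: graded_product_dsum.
- by rewrite -mulmxE -scalemxAr mulmxA aa mul1mx.
Qed.

Lemma chain_of x r k n (U a : 'M[F]_n) s (P : 'M[F]_s) :
    mxsim U (dsum (x%:M : 'M_r) (1%:M : 'M_k)) -> a *m a = 1%:M ->
  mxsim (i *: (a *m U)) P -> chain x r P.
Proof.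
move=> Us aa NP; exists k, n, U, a, 0%N, 1%:M; split=> //.
  exact: graded_product1.
apply: mxsim_trans NP _.
exact: mxsim_trans (dsum_empty_similar _ 1%:M) (dsumC_similar _ _).
Qed.

Lemma chain_start x e : e * e = 1 -> chain x 1 ((i * e * x)%:M : 'M_1).
Proof.
move=> ee; apply: (@chain_of x 1 0 1 x%:M e%:M).
- exact: dsum_empty_similar.
- by rewrite -scalar_mxM ee.
- by rewrite -scalar_mxM scale_scalar_mx mulrA; exact: mxsim_refl.
Qed.

Lemma chain_dsum x r s (P : 'M[F]_s) r' k n (U a : 'M[F]_n) s' (P' : 'M[F]_s') :
    chain x r P -> mxsim U (dsum (x%:M : 'M_r') (1%:M : 'M_k)) ->
    a *m a = 1%:M -> mxsim (i *: (a *m U)) P' ->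
  chain x (r + r') (dsum P P').
Proof.
move=> [k0 [n0 [U0 [a0 [n' [Y [Us aa gY NY]]]]]]] Us' aa' NP'.
exists (k0 + k)%N, (n0 + n)%N, (dsum U0 U), (dsum a0 a), n', Y; split=> //.
- apply: mxsim_trans (dsum_similar Us Us') _.
  by rewrite -dsum_scalar -dsum1; exact: dsum_interchange.
- by rewrite -dsumM aa aa' dsum1.
- rewrite -dsumM dsumZ; apply: mxsim_trans (dsum_similar NY NP') _.
  exact: mxsim_sym (dsumA_similar _ _ _).
Qed.

Lemma chain_absorb x r s (P : 'M[F]_s) s' (Q : 'M[F]_s') :
  graded_product P -> chain x r (dsum P Q) -> chain x r Q.
Proof.
move=> gP [k [n [U [a [n' [Y [Us aa gY NY]]]]]]].
exists k, n, U, a, (n' + s)%N, (dsum Y P); split=> //.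
  exact: graded_product_dsum.
exact: mxsim_trans NY (dsumA_similar _ _ _).
Qed.

Lemma brick_similar n (x : F) (E : 'M[F]_n) : x != 1 ->
  mxsim (block_mx x%:M E 0 1%:M) (dsum (x%:M : 'M_n) (1%:M : 'M_n)).
Proof.
move=> x1; apply: (split_ublock (Z := (1 - x)^-1 *: E)).
have x1' : 1 - x != 0 by rewrite subr_eq0 eq_sym.
rewrite mulmx1 mul_scalar_mx scalerA -[X in _ + X]scale1r -scalerDl.
by congr (_ *: _); field.
Qed.

Lemma brick_swap n (x : F) (C : 'M[F]_n) :
  i *: (block_mx 0 1%:M 1%:M 0 *m block_mx x%:M (- i *: C) 0 1%:M) =
  swap_step i x%:M C.
Proof.
rewrite mulmx_block !(mulmx0, mul0mx, mul1mx, mulmx1, addr0, add0r).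
rewrite scale_block_mx scaler0 scalemx1 scalerA mulrN ii opprK scale1r.
by [].
Qed.

Lemma swapK n :
  block_mx 0 1%:M 1%:M 0 *m block_mx 0 1%:M 1%:M 0 = 1%:M :> 'M[F]_(n + n).
Proof.
rewrite mulmx_block !(mulmx0, mul0mx, mul1mx, addr0, add0r).
by rewrite -scalar_mx_block.
Qed.

(** A brick with eigenvalue blocks [P^-1] and [x P] is added: [P^-1] is paired
    with the pending [P], and [x P] becomes the pending block. *)
Lemma chain_step x r s (P : 'M[F]_s) : x != 1 -> P \in unitmx ->
    1%:M - P *m P \in unitmx -> 1%:M - x *: (P *m P) \in unitmx ->
  chain x r P -> chain x (r + s) (x *: P).
Proof.
move=> x1 Pu u1 ux cP.
have unitB y : 1%:M - y *: (P *m P) \in unitmx -> invmx P - y *: P \in unitmx.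
  suff -> : 1%:M - y *: (P *m P) = P *m (invmx P - y *: P).
    by rewrite unitmx_mul => /andP[].
  by rewrite mulmxBr mulmxV// scalemxAr.
have gP : graded_product (dsum P (invmx P)).
  apply: (inverse_pair_graded ii) => //.
  by have := unitB 1; rewrite !scale1r; apply.
apply: (chain_absorb gP).
have NP := swap_step_split ii Pu (unitB x ux).
rewrite -brick_swap in NP.
have := chain_dsum cP (brick_similar _ x1) (swapK s) NP.
apply: chain_similar.
apply: mxsim_trans (dsumA_similar _ _ _).
by apply: dsum_similar (dsumC_similar _ _); exact: mxsim_refl.
Qed.

(** A vector fixed by [u], and multiplied by [e] under the involution, gives an
    additional eigenvalue [i e]. *)
Lemma chain_pad x r s (P : 'M[F]_s) e :
  e * e = 1 -> chain x r P -> chain x r (dsum P ((i * e)%:M : 'M_1)).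
Proof.
move=> ee cP; rewrite -[r]addn0.
apply: (chain_dsum (k := 1) (U := 1%:M) (a := e%:M) cP).
- apply: mxsim_trans (dsum_empty_similar _ x%:M) (dsumC_similar _ _).
- by rewrite -scalar_mxM ee.
- by rewrite mulmx1 scale_scalar_mx; exact: mxsim_refl.
Qed.

End Chains.

(** * Scalar matrices *)
Section Scalars.
Variables (F : fieldType) (i : F).
Hypotheses (ii : i * i = -1) (two0 : 2 != 0 :> F).

Let i0 : i != 0.
Proof. by apply/eqP => i0; move/eqP: ii; rewrite i0 mul0r eq_sym oppr_eq0 oner_eq0. Qed.

Lemma unitmx_scalar n (a : F) : a != 0 -> (a%:M : 'M_n) \in unitmx.
Proof. by move=> a0; rewrite unitmxE det_scalar unitfE expf_neq0. Qed.

Lemma chain_step1 x r p : x != 1 -> p != 0 -> p * p != 1 -> x * (p * p) != 1 ->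
  chain i x r (p%:M : 'M_1) -> chain i x r.+1 ((x * p)%:M : 'M_1).
Proof.
move=> x1 p0 p1 xp; rewrite -scale_scalar_mx -[r.+1]addn1.
apply: (chain_step ii x1); first exact: unitmx_scalar.
  by rewrite -scalar_mxM -raddfB unitmx_scalar// subr_eq0 eq_sym.
by rewrite -scalar_mxM scale_scalar_mx -raddfB unitmx_scalar// subr_eq0 eq_sym.
Qed.

(** The off-diagonal entry is kept as a parameter since it is multiplied by [x]
    at each step of a chain; only its being nonzero matters in the end. *)
Definition jordan2 (a b : F) : 'M[F]_(1 + 1) := block_mx a%:M b%:M 0 a%:M.

Lemma jordan2_similar a b b' : b != 0 -> b' != 0 ->
  mxsim (jordan2 a b) (jordan2 a b').
Proof.
move=> b0 b0'; exists (dsum 1%:M (b' / b)%:M), (dsum 1%:M (b / b')%:M).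
rewrite -!dsumM !mulmx1 -!scalar_mxM.
have -> : b' / b * (b / b') = 1 by field; rewrite b0 b0'.
have -> : b / b' * (b' / b) = 1 by field; rewrite b0 b0'.
rewrite dsum1 /jordan2 /dsum !mulmx_block -!scalar_mxM.
rewrite !(mul0mx, mulmx0, mul1mx, mulmx1, addr0, add0r) mulrC.
by split=> //; congr (block_mx _ (_ %:M) _ (_ %:M)); field.
Qed.

Lemma jordan2M a b a' b' :
  jordan2 a b *m jordan2 a' b' = jordan2 (a * a') (a * b' + b * a').
Proof.
rewrite /jordan2 mulmx_block !(mul0mx, mulmx0, addr0, add0r).
by rewrite -!scalar_mxM -raddfD.
Qed.

Lemma jordan2Z c a b : c *: jordan2 a b = jordan2 (c * a) (c * b).
Proof. by rewrite /jordan2 scale_block_mx !scale_scalar_mx scaler0. Qed.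

Lemma jordan2B a b : 1%:M - jordan2 a b = jordan2 (1 - a) (- b).
Proof.
rewrite [in LHS]scalar_mx_block /jordan2 opp_block_mx add_block_mx.
by rewrite oppr0 addr0 add0r -!raddfB -raddfN.
Qed.

Lemma jordan2_unit a b : a != 0 -> jordan2 a b \in unitmx.
Proof.
by move=> a0; rewrite unitmxE det_ublock unitrM !det_scalar !expr1 !unitfE a0.
Qed.

Lemma jordan2V a b : a != 0 -> invmx (jordan2 a b) = jordan2 a^-1 (- b / a ^+ 2).
Proof.
move=> a0; have JJ : jordan2 a b *m jordan2 a^-1 (- b / a ^+ 2) = 1%:M.
  rewrite jordan2M mulfV// [1%:M in RHS]scalar_mx_block /jordan2.
  by congr block_mx; rewrite -[RHS](raddf0 (@scalar_mx F 1)); congr scalar_mx; field.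
by rewrite -[LHS]mulmx1 -JJ mulKmx// jordan2_unit.
Qed.

Lemma chain_step2 x r p b : x != 1 -> p != 0 -> p * p != 1 -> x * (p * p) != 1 ->
  chain i x r (jordan2 p b) -> chain i x r.+2 (jordan2 (x * p) (x * b)).
Proof.
move=> x1 p0 p1 xp; rewrite -jordan2Z -[r.+2]addn2.
apply: (chain_step ii x1); first exact: jordan2_unit.
  by rewrite jordan2M jordan2B jordan2_unit// subr_eq0 eq_sym.
by rewrite jordan2M jordan2Z jordan2B jordan2_unit// subr_eq0 eq_sym.
Qed.

(** [q] is the order of [x] modulo the fourth roots of unity. *)
Definition fourth_period (x : F) q : Prop :=
  x ^+ (4 * q) = 1 /\ forall j, (0 < j < q)%N -> x ^+ (4 * j) != 1.

Lemma fourth_period_neq x q : fourth_period x q -> (1 < q)%N -> x != 1.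
Proof.
by move=> [_ xq] q1; have := xq 1%N q1; apply: contra => /eqP->; rewrite expr1n.
Qed.

Lemma fourth_period_pow x q t : fourth_period x q -> (0 < t < 2 * q)%N ->
  x ^+ t = -1 -> t = q.
Proof.
move=> [x4q xq] tq xt; have x4t : x ^+ (4 * t) = 1.
  by rewrite mulnC exprM xt; ring.
have [lt_tq|lt_qt|//] := ltngtP t q.
  by have /negP[] : x ^+ (4 * t) != 1; [apply: xq; lia|rewrite x4t].
have /negP[] : x ^+ (4 * (t - q)) != 1 by apply: xq; lia.
by move: x4t; rewrite -{1}(subnK (ltnW lt_qt)) mulnDr exprD x4q mulr1 => ->.
Qed.

Lemma fourth_period_neqN1 x q k : fourth_period x q -> (0 < k < q)%N ->
  - x ^+ (2 * k) != 1.
Proof.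
move=> [_ xq] /xq; apply: contra => /eqP x2.
rewrite (_ : 4 * k = 2 * k * 2)%N; last lia.
by rewrite (exprM x (2 * k)) -sqrrN x2 expr1n.
Qed.

(** The pending eigenvalue after [k] vectors is [p = i e x^k].  A step needs
    [p^2 <> 1] and [x p^2 <> 1]; as [p^2 = - x^(2 k)], the second condition
    could only fail for [2 k + 1 = q] and [x^q = -1]. *)
Lemma chain_iter1 x q e k : x != 0 -> fourth_period x q ->
    (x ^+ q = -1 -> q = 1%N) -> e * e = 1 ->
  (0 < k <= q)%N -> chain i x k ((i * e * x ^+ k)%:M : 'M_1).
Proof.
move=> x0 xq dq ee; case: k => // k; elim: k => [|k IH] /=.
  by move=> _; rewrite expr1; exact: chain_start.
move=> kq; have k1q : (0 < k.+1 < q)%N by [].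
have x1 : x != 1 by apply: fourth_period_neq xq _; lia.
have e0 : e != 0 by apply/eqP => e0; move/eqP: ee; rewrite e0 mul0r eq_sym oner_eq0.
have p2 : i * e * x ^+ k.+1 * (i * e * x ^+ k.+1) = - x ^+ (2 * k.+1).
  transitivity (i * i * (e * e) * (x ^+ k.+1 * x ^+ k.+1)); first ring.
  by rewrite ii ee mulr1 mulN1r -exprD addnn mul2n.
have -> : i * e * x ^+ k.+2 = x * (i * e * x ^+ k.+1).
  by rewrite exprS mulrCA.
apply: chain_step1 => //.
- by rewrite !mulf_neq0 ?expf_neq0.
- by rewrite p2; exact: fourth_period_neqN1 xq _.
- rewrite p2; apply/eqP => /eqP; rewrite mulrN eqr_oppLR -exprS => /eqP xk.
  have kE : (2 * k.+1).+1 = q by apply: fourth_period_pow xq _ xk; lia.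
  by rewrite kE in xk; have := dq xk; lia.
- by apply: IH; lia.
Qed.

Lemma inverse_scalars_graded :
  graded_product (dsum ((- i)%:M : 'M[F]_1) (i%:M : 'M[F]_1)).
Proof.
have iV : (- i)^-1 = i by apply: (mulfI (x := - i)); rewrite ?oppr_eq0// mulfV
  ?oppr_eq0// mulNr ii opprK.
have -> : i%:M = invmx (- i)%:M :> 'M[F]_1 by rewrite invmx_scalar iV.
apply: (inverse_pair_graded ii); first by rewrite unitmx_scalar ?oppr_eq0.
rewrite invmx_scalar iV -raddfB unitmx_scalar// opprK.
by rewrite -[i]mul1r -mulrDl mulf_neq0.
Qed.

(** Unlike [dsum_similar], this keeps track of the off-diagonal block. *)
Lemma ublock_similar m n n' (A : 'M[F]_m) (B : 'M[F]_(m, n)) (C : 'M[F]_n)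
    (C' : 'M[F]_n') (P : 'M_(n, n')) (Q : 'M_(n', n)) :
    P *m Q = 1%:M -> Q *m P = 1%:M -> C *m P = P *m C' ->
  mxsim (block_mx A B 0 C) (block_mx A (B *m P) 0 C').
Proof.
move=> PQ QP CP; exists (block_mx 1%:M 0 0 P), (block_mx 1%:M 0 0 Q).
rewrite !mulmx_block !(mul0mx, mulmx0, mul1mx, mulmx1, addr0, add0r).
by rewrite PQ QP CP -!scalar_mx_block.
Qed.

(** A chain of Jordan blocks starts with two vectors scaled by [x] and one
    fixed vector, coupled so that the eigenvalues are [i x] with a Jordan block
    of size 2, and [-i], which is paired with [i] on another fixed vector. *)
Lemma chain_start2 x : x != 0 -> x != 1 -> x != -1 ->
  chain i x 2 (jordan2 (i * x) 1).
Proof.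
move=> x0 x1 xN1.
(* [C] is the sum of the roots [- i] and [i x] of [t^2 - t C + x]; the value of
   [E1] normalizes the coupling with the first vector to [1]. *)
pose C : 'M[F]_1 := (- i)%:M + (i * x)%:M.
pose E1 : 'M[F]_1 := - i *: x^-1%:M.
pose V : 'M[F]_(1 + 1) := block_mx x%:M (- i *: C) 0 1%:M.
pose U : 'M[F]_(1 + (1 + 1)) := block_mx x%:M (row_mx 0 E1) 0 V.
pose sw : 'M[F]_(1 + 1) := block_mx 0 1%:M 1%:M 0.
have Us : mxsim U (dsum (x%:M : 'M_2) (1%:M : 'M_1)).
  apply: mxsim_trans (_ : mxsim _ (dsum x%:M V)) _.
    apply: (split_ublock (Z := row_mx 0 ((1 - x)^-1 *: E1))).
    have x1' : 1 - x != 0 by rewrite subr_eq0 eq_sym.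
    rewrite mul_row_block mul_mx_row !(mulmx0, mul0mx, mulmx1, addr0, add0r).
    rewrite add_row_mx addr0 mul_scalar_mx scalerA -[X in _ + X]scale1r.
    by rewrite -scalerDl; congr (row_mx _ (_ *: _)); field.
  have := dsum_similar (mxsim_refl (x%:M : 'M_1)) (brick_similar (- i *: C) x1).
  by move/mxsim_trans; apply; rewrite -(@dsum_scalar _ 1 1); exact: dsumA_similar.
have cJ : chain i x 2 (dsum (jordan2 (i * x) 1) ((- i)%:M : 'M_1)).
  apply: (chain_of (a := dsum 1%:M sw) Us).
    by rewrite -dsumM mulmx1 swapK dsum1.
  have -> : i *: (dsum 1%:M sw *m U) =
      block_mx (i * x)%:M (row_mx 0 x^-1%:M) 0 (swap_step i x%:M C).
    rewrite /dsum /U mulmx_block !(mul1mx, mul0mx, mulmx0, addr0, add0r).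
    rewrite scale_block_mx (brick_swap ii) scaler0 scale_scalar_mx.
    by rewrite scale_row_mx scaler0 scalerA mulrN ii opprK scale1r.
  have -> : x%:M = (- i)%:M *m (i * x)%:M :> 'M[F]_1.
    by rewrite -scalar_mxM mulrA mulNr ii opprK mul1r.
  set T := (i * x)%:M; set G := (- i)%:M.
  have QP := shear_inv (i *: T); have PQ := shear_inv (- (i *: T)).
  rewrite opprK in PQ.
  apply: mxsim_trans (ublock_similar _ _ PQ QP (swap_step_shear ii G T)) _.
  rewrite mul_row_block !(mul0mx, mulmx1, add0r, addr0).
  have -> : x^-1%:M *m - (i *: T) = 1%:M.
    rewrite scale_scalar_mx -raddfN /= -scalar_mxM mulrA ii mulN1r opprK.
    by rewrite mulVf.
  have := @block_mxA _ 1 1 1 1 1 1 T 1%:M x^-1%:M 0 T i%:M 0 0 G.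
  rewrite row_mx0 col_mx0 => /= ->.
  apply: mxsim_trans (mxsim_sym (mxsim_cast _ _)) _.
  set A := block_mx T _ _ _; set B := col_mx _ _.
  have Au : A + i%:M \in unitmx.
    have -> : A + i%:M = jordan2 (i * x + i) 1.
      rewrite [X in _ + X]scalar_mx_block add_block_mx !addr0.
      by rewrite /jordan2 -!raddfD.
    apply: jordan2_unit; rewrite -[X in _ + X]mulr1 -mulrDr mulf_neq0//.
    by rewrite addr_eq0.
  apply: (split_ublock (Z := - (invmx (A + i%:M) *m B))).
  have := mulKVmx Au B; set Z := invmx _ *m B.
  rewrite mulmxDl mul_scalar_mx mulmxN => <-; rewrite addKr.
  by rewrite mulNmx mul_mx_scalar scaleNr opprK.
apply: (chain_absorb inverse_scalars_graded).
have := chain_pad (mulr1 1) cJ; rewrite mulr1; apply: chain_similar.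
apply: mxsim_trans (dsumC_similar _ _).
exact: mxsim_sym (dsumA_similar _ _ _).
Qed.

(** The pending eigenvalue runs through [i x, i x^2, ...] as in [chain_iter1],
    but each link uses two vectors. *)
Lemma chain_iter2 x q l : x != 0 -> fourth_period x q -> x != -1 ->
  (2 * l + 3 <= q)%N ->
  exists2 b, b != 0 & chain i x (2 * l + 2) (jordan2 (i * x ^+ l.+1) b).
Proof.
move=> x0 xq xN1; elim: l => [|l IH] lq.
  exists 1; rewrite ?oner_eq0// expr1 muln0 add0n.
  by apply: chain_start2 => //; apply: fourth_period_neq xq _; lia.
have [|b b0 cJ] := IH; first lia.
have p2 : i * x ^+ l.+1 * (i * x ^+ l.+1) = - x ^+ (2 * l.+1).
  by rewrite mulrACA ii mulN1r -exprD addnn mul2n.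
exists (x * b); first by rewrite mulf_neq0.
rewrite (_ : 2 * l.+1 + 2 = (2 * l + 2).+2)%N; last lia.
have -> : i * x ^+ l.+2 = x * (i * x ^+ l.+1) by rewrite exprS mulrCA.
apply: chain_step2 => //.
- by apply: fourth_period_neq xq _; lia.
- by rewrite mulf_neq0// expf_neq0.
- by rewrite p2; apply: fourth_period_neqN1 xq _; lia.
- rewrite p2; apply/eqP => /eqP; rewrite mulrN eqr_oppLR -exprS => /eqP xk.
  by have := fourth_period_pow xq _ xk; lia.
Qed.

(** If [x p^2 = 1], a last vector scaled by [x] and a fixed one carry a Jordan
    block for [p^-1], the double root of [t^2 - 2 p^-1 t + x]. *)
Lemma chain_close2 x r p b : x != 1 -> p != 0 -> b != 0 -> p * p != 1 ->
  x * (p * p) = 1 -> chain i x r (jordan2 p b) -> scaled i x r.+1.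
Proof.
move=> x1 p0 b0 p1 xp cP.
have gP : graded_product (dsum (jordan2 p b) (invmx (jordan2 p b))).
  apply: (inverse_pair_graded ii); first exact: jordan2_unit.
  have Ju := jordan2_unit b p0.
  have : jordan2 p b *m (invmx (jordan2 p b) - jordan2 p b) \in unitmx.
    by rewrite mulmxBr mulmxV// jordan2M jordan2B jordan2_unit// subr_eq0 eq_sym.
  by rewrite unitmx_mul => /andP[].
apply: (chain_close gP); rewrite -[r.+1]addn1.
pose T : 'M[F]_1 := p^-1%:M.
have TT : x%:M = T *m T.
  by rewrite -scalar_mxM; congr scalar_mx; rewrite -[RHS]mul1r -xp; field.
apply: chain_dsum cP (brick_similar (- i *: (T + T)) x1) (swapK F 1) _.
rewrite (brick_swap ii) TT; apply: mxsim_trans (swap_step_similar ii T T) _.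
rewrite jordan2V//; apply: (@jordan2_similar p^-1 i) => //.
by rewrite mulf_neq0 ?oppr_eq0 ?invr_eq0 ?expf_neq0.
Qed.

Lemma fourth_root_cases d : d ^+ 4 = 1 -> [\/ d = 1, d = -1, d = i | d = - i].
Proof.
move=> d4; have /eqP : (d - 1) * (d + 1) * ((d - i) * (d + i)) = 0.
  transitivity ((d ^+ 2 - 1) * (d ^+ 2 - i * i)); first ring.
  by rewrite ii; transitivity (d ^+ 4 - 1); [ring|rewrite d4 subrr].
rewrite !mulf_eq0 !subr_eq0 !addr_eq0 => /orP[/orP[]|/orP[]] /eqP ->.
- exact: Or41.
- exact: Or42.
- exact: Or43.
- exact: Or44.
Qed.

(** A leftover eigenvalue [i] or [-i] is paired with its opposite, which is also
    its inverse. *)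
Lemma chain_close_unit x r d : (d = i \/ d = - i) ->
  chain i x r (d%:M : 'M_1) -> scaled i x r.
Proof.
move=> di cd.
have [e ee ed] : exists2 e, e * e = 1 & i * e = - d.
  case: di => ->; first by exists (-1); rewrite ?mulrNN ?mulr1 ?mulrN1.
  by exists 1; rewrite ?mulr1 ?opprK.
have := chain_pad ee cd; rewrite ed; apply: chain_close.
case: di => ->; last by rewrite opprK; exact: inverse_scalars_graded.
by apply: graded_product_similar (dsumC_similar _ _) _; exact: inverse_scalars_graded.
Qed.

(** The leftover eigenvalue [i e x^q] is a fourth root of unity, and the sign [e]
    is chosen so that it is not [-1].  When [x^q = -1] and [q > 1], [q] is odd
    by minimality, say [q = 2 l + 3]: the chain of Jordan blocks starts with two
    vectors, makes [l] steps with two vectors each, and closes with one. *)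
Lemma scaled_fourth_period x q : x != 0 -> (0 < q)%N -> fourth_period x q ->
  scaled i x q.
Proof.
move=> x0 q0 xq; have q4 : (x ^+ q) ^+ 4 = 1 by case: xq; rewrite mulnC exprM.
have NN : -1 * -1 = 1 :> F by rewrite mulrNN mulr1.
have qq : (0 < q <= q)%N by rewrite q0 leqnn.
have [[q1 xqN]|it] : (1 < q)%N /\ x ^+ q = -1 \/
    forall e, e * e = 1 -> chain i x q ((i * e * x ^+ q)%:M : 'M_1).
  have [q1|q1] := leqP q 1; last have [xqN|xqN] := eqVneq (x ^+ q) (-1).
  - by right=> e ee; apply: (chain_iter1 (q := q)) => // _; lia.
  - by left.
  - by right=> e ee; apply: (chain_iter1 (q := q)) => // /eqP; rewrite (negPf xqN).
  have x1 := fourth_period_neq xq q1.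
  have qodd : odd q.
    apply: contraT => qev; have qE : q = (2 * q./2)%N.
      by rewrite mul2n even_halfK.
    have := fourth_period_neqN1 (k := q./2) xq; rewrite -qE xqN opprK eqxx.
    by move=> /(_ ltac:(lia)).
  have xN1 : x != -1.
    case: xq => _ /(_ 1%N q1); apply: contra => /eqP->.
    by rewrite (_ : 4 * 1 = 2 * 2)%N// exprM sqrrN !expr1n.
  pose l := (q - 3)./2; have qE : q = (2 * l + 3)%N by rewrite /l; lia.
  have [|b b0 cJ] := chain_iter2 (l := l) x0 xq xN1; first lia.
  have p2 : i * x ^+ l.+1 * (i * x ^+ l.+1) = - x ^+ (2 * l.+1).
    by rewrite mulrACA ii mulN1r -exprD addnn mul2n.
  have := @chain_close2 x (2 * l + 2) (i * x ^+ l.+1) b x1.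
  rewrite (_ : (2 * l + 2).+1 = q); last lia.
  apply=> //; first by rewrite mulf_neq0// expf_neq0.
    by rewrite p2; apply: fourth_period_neqN1 xq _; lia.
  rewrite p2 mulrN -exprS (_ : (2 * l.+1).+1 = q)%N; last lia.
  by rewrite xqN opprK.
have [] := fourth_root_cases q4 => xqE.
- apply: chain_close_unit (it 1 (mulr1 1)).
  by left; rewrite xqE !mulr1.
- apply: chain_close_unit (it 1 (mulr1 1)).
  by right; rewrite xqE mulr1 mulrN1.
- apply: chain_close (it (-1) NN).
  by rewrite xqE mulrN1 mulNr ii opprK; exact: graded_product1.
- apply: chain_close (it 1 (mulr1 1)).
  by rewrite xqE mulr1 mulrN ii opprK; exact: graded_product1.
Qed.

Lemma scaled_add x r s : scaled i x r -> scaled i x s -> scaled i x (r + s).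
Proof.
move=> [k gk] [l gl]; exists (k + l)%N.
have := inv_graded_product_dsum gk gl; rewrite -dsumZ.
apply: inv_graded_product_similar; apply: mxsim_scale.
by rewrite -dsum_scalar -dsum1; exact: dsum_interchange.
Qed.

(** Any other exponent splits into two smaller ones with the same property. *)
Lemma scaled_fourth x r : x != 0 -> (0 < r)%N -> x ^+ (4 * r) = 1 -> scaled i x r.
Proof.
move=> x0; elim/ltn_ind: r => r IH r0 xr.
have [[k kr xk]|nok] := pselect (exists2 k, (0 < k < r)%N & x ^+ (4 * k) = 1).
  have kr' : (k <= r)%N by lia.
  rewrite -(subnK kr'); apply: scaled_add; last by apply: IH => //; lia.
  apply: IH; [lia|lia|].
  by move: xr; rewrite -{1}(subnK kr') mulnDr exprD xk mulr1.
apply: scaled_fourth_period => //; split=> // j jr; apply/eqP => xj.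
by apply: nok; exists j.
Qed.

End Scalars.

(** * Nonscalar matrices *)
Section NonScalar.
Variable F : fieldType.

Lemma mxsim_det n (A B : 'M[F]_n) : mxsim A B -> \det A = \det B.
Proof.
move=> [P [Q [PQ _ AP]]]; rewrite (mxsimE PQ AP) !det_mulmx.
by rewrite mulrAC -det_mulmx PQ det1 mul1r.
Qed.

(** Comparing the eigenvalues of two basis vectors with that of their sum. *)
Lemma eigen_scalar n (D : 'M[F]_n) :
  (forall x : 'rV_n, exists a, x *m D = a *: x) -> is_scalar_mx D.
Proof.
case: n D => [|n] D eig; first by apply/is_scalar_mxP; exists 0; apply/matrixP => -[].
have D0 k l : k != l -> D k l = 0.
  move=> kl; have [a] := eig (delta_mx 0 k).
  move/(congr1 (fun M : 'rV_n.+1 => M 0 l)); rewrite -rowE !mxE eqxx /=.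
  by rewrite eq_sym (negPf kl) mulr0.
have DD k : D k k = D 0 0.
  have [->//|k0] := eqVneq k 0.
  have [a] := eig (delta_mx 0 0 + delta_mx 0 k); rewrite mulmxDl -!rowE => Da.
  have := congr1 (fun M : 'rV_n.+1 => M 0 0) Da.
  have := congr1 (fun M : 'rV_n.+1 => M 0 k) Da.
  rewrite !mxE !eqxx /= (negPf k0) eq_sym (negPf k0) D0 //; last first.
    by rewrite eq_sym.
  by rewrite !mulrb !add0r addr0 (D0 k 0)// addr0 => -> ->.
apply/is_scalar_mxP; exists (D 0 0); apply/matrixP => k l; rewrite mxE.
by have [->|/D0->] := eqVneq k l; rewrite ?mulr1n ?mulr0n.
Qed.

Lemma complete_row m (x : 'rV[F]_(1 + m)) : x != 0 ->
  exists2 P : 'M[F]_(1 + m), P \in unitmx & usubmx P = x.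
Proof.
move=> x0; pose c := col_ebase x 0 0.
have cE : col_ebase x = c%:M by rewrite [LHS]mx11_scalar.
have c0 : c != 0.
  by have := col_ebase_unit x; rewrite cE unitmxE det_scalar1 unitfE.
exists (c *: row_ebase x); first by rewrite unitmxZ ?row_ebase_unit// unitfE.
have := mulmx_ebase x; rewrite rank_rV x0 cE mul_scalar_mx -scalemxAl => xE.
rewrite -[RHS]xE linearZ /=; congr (_ *: _).
by rewrite -[X in _ *m X]vsubmxK pid_mx_row mul_row_col mul0mx addr0
  mul1mx.
Qed.

(** The first vector of the new basis is not an eigenvector. *)
Lemma nonscalar_corner m (D : 'M[F]_(1 + m)) : ~~ is_scalar_mx D ->
  exists (a : 'M_1) b c (D' : 'M_m), b != 0 /\ mxsim D (block_mx a b c D').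
Proof.
move=> Dn; have [x xD] : exists x : 'rV_(1 + m), forall a, x *m D != a *: x.
  apply: contrapT => nx; case/negP: Dn; apply: eigen_scalar => x.
  apply: contrapT => xD; apply: nx; exists x => a; apply/eqP => xDa.
  by apply: xD; exists a.
have x0 : x != 0.
  by apply: contra (xD 0) => /eqP->; rewrite mul0mx scaler0.
have [P Pu Px] := complete_row x0.
pose A := P *m D *m invmx P.
exists (ulsubmx A), (ursubmx A), (dlsubmx A), (drsubmx A).
rewrite submxK; split; last exact/mxsim_sym/mxsim_conj.
apply/eqP => A0; case/negP: (xD (ulsubmx A 0 0)).
have : usubmx (A *m P) = usubmx (P *m D) by rewrite /A mulmxKV.
rewrite -{1}[A]submxK -{1}[P]vsubmxK mul_block_col col_mxKu A0 mul0mx addr0.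
by rewrite {1}[ulsubmx A]mx11_scalar mul_scalar_mx -mul_usub_mx Px => ->.
Qed.

Lemma shear_similar m (a : 'M[F]_1) b c (D : 'M[F]_m) (t : 'cV_m) :
  mxsim (block_mx a b c D)
    (block_mx (a - b *m t) b (t *m a + c - (t *m b + D) *m t) (t *m b + D)).
Proof.
apply: mxsim_sym.
exists (block_mx 1%:M 0 t 1%:M), (block_mx 1%:M 0 (- t) 1%:M).
rewrite !mulmx_block !(mul0mx, mulmx0, mul1mx, mulmx1, addr0, add0r).
rewrite addNr addrN -scalar_mx_block; split=> //.
by rewrite subrK subrK.
Qed.

Lemma right_inverse_row m (b : 'rV[F]_m) : b != 0 ->
  exists t : 'cV_m, b *m t = 1%:M.
Proof. by move=> b0; apply/row_freeP; rewrite /row_free rank_rV b0. Qed.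

(** A shear along [t] subtracts [b t] from the upper left entry, which can so be
    given any value.  If the Schur complement then is a scalar [s], a shear
    along some nonzero [v] with [b v = 0] keeps the corner and changes the Schur
    complement into [s (1 + a^-1 v b)], where [v b] is nilpotent and nonzero. *)
Lemma schur_corner m (D : 'M[F]_(1 + m)) (a : F) :
    ~~ is_scalar_mx D -> D \in unitmx -> a != 0 ->
  exists (b : 'rV_m) c (D' : 'M_m), [/\ b != 0, mxsim D (block_mx a%:M b c D') &
    (1 < m)%N -> ~~ is_scalar_mx (D' - a^-1 *: (c *m b))].
Proof.
move=> Dn Du a0; have [m0 [b [c0 [D0 [b0 DE0]]]]] := nonscalar_corner Dn.
have [t bt] := right_inverse_row b0.
have [c [D1 DE1]] : exists c D1, mxsim D (block_mx a%:M b c D1).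
  have := shear_similar m0 b c0 D0 (t *m (m0 - a%:M)).
  rewrite mulmxA bt mul1mx subKr => DE1.
  by do 2! eexists; exact: mxsim_trans DE0 DE1.
pose S := D1 - a^-1 *: (c *m b).
have [/andP[m1 Ss]|Sn] := boolP ((1 < m)%N && is_scalar_mx S); last first.
  exists b, c, D1; split=> // m1; by rewrite m1 in Sn.
have [s SE] := is_scalar_mxP Ss.
have D1E : D1 = s%:M + a^-1 *: (c *m b) by rewrite -SE subrK.
have s0 : s != 0.
  apply: contraL Du => /eqP s0; rewrite unitmxE (mxsim_det DE1) D1E s0.
  rewrite raddf0 add0r.
  have -> : block_mx a%:M b c (a^-1 *: (c *m b)) =
      block_mx 1%:M 0 (a^-1 *: c) 1%:M *m block_mx a%:M b 0 0.
    rewrite mulmx_block !(mul0mx, mulmx0, mul1mx, addr0).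
    by rewrite mul_mx_scalar scalerA mulfV// scale1r scalemxAl.
  have d0 : \det (0 : 'M[F]_m) = 0.
    by rewrite -(raddf0 (@scalar_mx F m)) det_scalar expr0n (gtn_eqF (ltnW m1)).
  by rewrite det_mulmx det_ublock d0 !mulr0 unitr0.
have [v v0 bv] : exists2 v : 'cV_m, v != 0 & b *m v = 0.
  have : kermx b^T != 0.
    by rewrite -mxrank_eq0 mxrank_ker mxrank_tr rank_rV b0; lia.
  case/rowV0Pn => v /sub_kermxP vb v0; exists v^T.
    by rewrite -trmx_eq0 trmxK.
  by rewrite -[b]trmxK -trmx_mul vb trmx0.
have := shear_similar a%:M b c D1 v; rewrite bv subr0 => DE2.
exists b, (v *m a%:M + c - (v *m b + D1) *m v), (v *m b + D1).
split=> //; first exact: mxsim_trans DE1 DE2.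
move=> _; apply/negP => /is_scalar_mxP[l].
have D1v : D1 *m v = s *: v.
  by rewrite D1E mulmxDl mul_scalar_mx -scalemxAl -mulmxA bv mulmx0 scaler0 addr0.
have -> : v *m a%:M + c - (v *m b + D1) *m v = a *: v + c - s *: v.
  by rewrite mulmxDl -mulmxA bv mulmx0 add0r D1v mul_mx_scalar.
rewrite mulmxBl mulmxDl -!scalemxAl scalerBr scalerDr scalerA mulVf// scale1r.
have zmE (W : zmodType) (X Y Z T : W) : X + (T + Y) - (X + Y - Z) = T + Z.
  by rewrite opprB (addrCA X) -addrA; congr (_ + _); rewrite addrC subrK.
rewrite D1E zmE scalerA => vbE.
have ls : l = s.
  have := congr1 (mulmx^~ v) vbE.
  rewrite mulmxDl -scalemxAl -mulmxA bv mulmx0 scaler0 addr0 !mul_scalar_mx.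
  by move/eqP; rewrite -subr_eq0 -scalerBl scaler_eq0 (negPf v0) orbF subr_eq0
    => /eqP.
case/negP: v0; apply/eqP; rewrite -[v]mulmx1 -bt mulmxA.
have /eqP : (a^-1 * s) *: (v *m b) = 0.
  by apply: (addrI s%:M); rewrite vbE ls addr0.
rewrite scaler_eq0 mulf_eq0 invr_eq0 (negPf a0) (negPf s0) => /eqP->.
by rewrite mul0mx.
Qed.

Lemma schur_factor m (a : F) (b : 'rV_m) c (D : 'M[F]_m) (G T : 'M_m) :
    a != 0 -> D - a^-1 *: (c *m b) = G *m T ->
  block_mx a%:M b c D =
  block_mx 1%:M 0 (a^-1 *: c) G *m block_mx a%:M b 0 T.
Proof.
move=> a0 SE; rewrite mulmx_block !(mul0mx, mulmx0, mul1mx, addr0) -SE.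
by rewrite mul_mx_scalar scalerA mulfV// scale1r -scalemxAl addrC subrK.
Qed.

Lemma det_schur m (a : F) (b : 'rV_m) c (D : 'M[F]_m) : a != 0 ->
  \det (block_mx a%:M b c D) = a * \det (D - a^-1 *: (c *m b)).
Proof.
move=> a0; rewrite (schur_factor a0 (esym (mul1mx _))).
by rewrite det_mulmx det_lblock det_ublock !det1 !mul1r det_scalar1.
Qed.

Lemma scalar_det1 m (S : 'M[F]_m) : (m <= 1)%N -> \det S = 1 -> S = 1%:M.
Proof.
case: m S => [|[|//]] S _; first by move=> _; apply/matrixP => -[].
by rewrite [S in _ -> S = _]mx11_scalar det_mx11 => ->.
Qed.

(** Triangular factorization with unit diagonal entries: at each step the upper
    left entry is made equal to [1] and the Schur complement is factored by
    induction.  It is the identity once its size is at most 1, having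
    determinant 1. *)
Lemma unipotent_factors m (D : 'M[F]_m) : \det D = 1 ->
    (is_scalar_mx D -> D = 1%:M) ->
  exists G T : 'M_m, [/\ nilp (G - 1%:M), nilp (T - 1%:M) & D = G *m T].
Proof.
elim: m D => [|m IH] D D1 Ds.
  exists 1%:M, 1%:M; rewrite subrr; split; [exact: nilp0|exact: nilp0|].
  by apply/matrixP => -[].
have [/Ds->|Dn] := boolP (is_scalar_mx D).
  by exists 1%:M, 1%:M; rewrite subrr mulmx1; split=> //; exact: nilp0.
have Du : D \in unitmx by rewrite unitmxE D1 unitr1.
have [b [c [D' [b0 DE Sn]]]] := @schur_corner m D 1 Dn Du (oner_neq0 _).
have S1 : \det (D' - 1^-1 *: (c *m b)) = 1.
  by rewrite -[LHS]mul1r -det_schur ?oner_eq0// -(mxsim_det DE).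
have [|G [T [nG nT SE]]] := IH _ S1.
  have [m1|m1] := leqP m 1; first by move=> _; exact: scalar_det1.
  by move=> Ss; move: (Sn m1); rewrite Ss.
case: DE => P [Q [PQ QP DP]].
pose L := block_mx 1%:M 0 (1^-1 *: c) G; pose U := block_mx 1%:M b 0 T.
exists (P *m L *m Q), (P *m U *m Q); split.
- apply: (@nilp_similar _ _ _ _ (L - 1%:M)).
    exists P, Q; split=> //; rewrite mulmxBl mulmxBr mul1mx mulmx1.
    by rewrite -[X in X - _]mulmxA QP mulmx1.
  rewrite [X in _ - X]scalar_mx_block opp_block_mx add_block_mx subrr subr0.
  by rewrite subr0; apply: nilp_lblock => //; exact: nilp0.
- apply: (@nilp_similar _ _ _ _ (U - 1%:M)).
    exists P, Q; split=> //; rewrite mulmxBl mulmxBr mul1mx mulmx1.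
    by rewrite -[X in X - _]mulmxA QP mulmx1.
  rewrite [X in _ - X]scalar_mx_block opp_block_mx add_block_mx subrr subr0.
  by rewrite subr0; apply: nilp_block => //; exact: nilp0.
- rewrite (mxsimE PQ DP) (schur_factor (oner_neq0 _) SE).
  by rewrite !mulmxA -(mulmxA _ Q P) QP mulmx1.
Qed.

End NonScalar.

(** * Factoring the finite-dimensional part *)
Section MatrixTheorem.
Variables (F : fieldType) (i : F).
Hypotheses (ii : i * i = -1) (two0 : 2 != 0 :> F).

(** [D] is the matrix of [u] on the image of [u - 1], and the columns of [E]
    give the images under [u - 1] of [c] additional vectors.  That [D - 1] and
    [E] together have full rank means that these vectors and the original ones
    have the same image under [u - 1] as the whole space. *)
Definition realizable r (D : 'M[F]_r) : Prop :=
  exists c (E : 'M[F]_(r, c)), row_free (row_mx (D - 1%:M) E) /\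
    inv_graded_product (i *: block_mx D E 0 1%:M).

Lemma inv_graded_product_left n (a U : 'M[F]_n) : a *m a = 1%:M ->
  graded_product (i *: (a *m U)) -> inv_graded_product (i *: U).
Proof.
move=> aa gN; exists a, (i *: (a *m U)); split=> //.
by rewrite -mulmxE -scalemxAr mulmxA aa mul1mx.
Qed.

Lemma realizable_similar r (D D' : 'M[F]_r) :
  mxsim D D' -> realizable D' -> realizable D.
Proof.
move=> [P [Q [PQ QP DP]]] [c [E [/row_freeP[B EB] gE]]].
exists c, (P *m E); split.
  apply/row_freeP; exists (block_mx P 0 0 1%:M *m B *m Q).
  rewrite !mulmxA mul_row_block !mulmx0 addr0 add0r mulmx1.
  have -> : row_mx ((D - 1%:M) *m P) (P *m E) = P *m row_mx (D' - 1%:M) E.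
    by rewrite mul_mx_row mulmxBl mulmxBr DP mul1mx mulmx1.
  by rewrite -(mulmxA P) EB mulmx1.
apply: inv_graded_product_similar gE; apply: mxsim_scale.
exists (dsum P 1%:M), (dsum Q 1%:M); rewrite -!dsumM PQ QP !mulmx1 !dsum1.
rewrite /dsum !mulmx_block !(mul0mx, mulmx0, mul1mx, mulmx1, addr0, add0r).
by rewrite DP.
Qed.

Lemma realizable_pad r (D : 'M[F]_r) c (E : 'M[F]_(r, c)) :
    row_free (row_mx (D - 1%:M) E) ->
    inv_graded_product (i *: dsum (block_mx D E 0 1%:M) (1%:M : 'M_1)) ->
  realizable D.
Proof.
move=> /row_freeP[B EB] gE; exists (c + 1)%N, (row_mx E 0); split.
  apply/row_freeP; exists (col_mx (usubmx B) (col_mx (dsubmx B) 0)).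
  by rewrite !mul_row_col mul0mx addr0 -mul_row_col vsubmxK.
apply: inv_graded_product_similar gE; apply: mxsim_scale.
have := @block_mxA _ r c 1 r c 1 D E 0 0 1%:M 0 0 0 1%:M.
rewrite !col_mx0 !row_mx0 -scalar_mx_block => /= ->.
exact: mxsim_sym (mxsim_cast _ _).
Qed.

(** For [D = 1], the choice [E = - i] yields [swap_step 1 1]; the other scalars
    are covered by the chains of eigenvalues. *)
Lemma realizable_scalar r (x : F) : \det (x%:M : 'M_r) ^+ 4 = 1 ->
  realizable (x%:M : 'M_r).
Proof.
rewrite det_scalar => xr.
have [|nx] := boolP ((x == 1) || (r == 0%N)).
  move=> x1; have -> : x%:M = 1%:M :> 'M_r.
    by case/orP: x1 => /eqP => [->//|r0]; subst r; apply/matrixP => -[].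
  exists r, (- i *: 1%:M); split.
    apply/row_freeP; exists (col_mx 0 (i *: 1%:M)).
    rewrite mul_row_col subrr mul0mx add0r -scalemxAl -scalemxAr mulmx1.
    by rewrite scalerA mulNr ii opprK scale1r.
  apply: (inv_graded_product_left (swapK F r)).
  by rewrite (brick_swap ii); exact: swap_step1_graded.
move: nx; rewrite negb_or => /andP[x1 r0].
have x0 : x != 0.
  apply/eqP => x0; move: xr; rewrite x0 -exprM expr0n muln_eq0 (negPf r0) /=.
  by move=> /esym/eqP; rewrite oner_eq0.
have x4r : x ^+ (4 * r) = 1 by rewrite mulnC exprM.
have r_gt0 : (0 < r)%N by rewrite lt0n.
have [k gk] := scaled_fourth ii two0 x0 r_gt0 x4r.
exists k, 0; split=> //.
apply/row_freeP; exists (col_mx ((x - 1)^-1)%:M 0).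
by rewrite mul_row_col mul0mx addr0 -raddfB -scalar_mxM mulfV// subr_eq0.
Qed.

Lemma lblock_similar m n n' (A : 'M[F]_m) (B : 'M[F]_(n, m)) (C : 'M[F]_n)
    (C' : 'M[F]_n') (P : 'M_(n, n')) (Q : 'M_(n', n)) :
    P *m Q = 1%:M -> Q *m P = 1%:M -> C *m P = P *m C' ->
  mxsim (block_mx A 0 B C) (block_mx A 0 (Q *m B) C').
Proof.
move=> PQ QP CP; exists (block_mx 1%:M 0 0 P), (block_mx 1%:M 0 0 Q).
rewrite !mulmx_block !(mul0mx, mulmx0, mul1mx, mulmx1, addr0, add0r).
by rewrite mulmxA PQ QP CP mul1mx -!scalar_mx_block.
Qed.

Section Corner.
Variables (m : nat) (d e : F) (b : 'rV[F]_m) (c : 'cV[F]_m).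
Variables (D G T : 'M[F]_m).
Hypotheses (d0 : d != 0) (ee : e * e = 1) (b0 : b != 0).
Hypothesis SE : D - d^-1 *: (c *m b) = G *m T.
Hypotheses (nG : nilp (G - 1%:M)) (nT : nilp (T - 1%:M)).

(* The basis consists of a first vector, an eigenvector of the involution for
   the eigenvalue [e], and of two families of [m] vectors that the involution
   exchanges.  [E1] is chosen so that, after adding suitable multiples of the
   first vector to the first family, the remaining exchange only involves the
   Schur complement [G T] (lemma [corner_similar]). *)
Let E1 : 'rV[F]_m := - (e / d) *: b.
Let E2 : 'M[F]_m := - i *: (G + T).
Let D1 : 'M[F]_(1 + m) := block_mx d%:M b c D.
Let E : 'M[F]_(1 + m, m) := col_mx E1 E2.

(** A row vector [(t, w)] killed by [D1 - 1] and [E] satisfies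
    [w (G - i e) (T - i e) = 0], and [G] and [T] do not have the eigenvalue
    [i e <> 1]. *)
Lemma corner_row_free : row_free (row_mx (D1 - 1%:M) E).
Proof.
apply: inj_row_free => v; rewrite -[v]hsubmxK; set w := rsubmx v.
rewrite {1}[lsubmx v]mx11_scalar; set t := lsubmx v 0 0.
rewrite [1%:M]scalar_mx_block opp_block_mx add_block_mx !oppr0 !addr0.
rewrite mul_mx_row mul_row_block mul_row_col -row_mx0 => /eq_row_mx[].
rewrite -row_mx0 => /eq_row_mx[v1 v2] v3.
have wcE : w *m c = - (t * (d - 1))%:M.
  by apply/eqP; rewrite -addr_eq0 addrC -v1 -raddfB -scalar_mxM.
have DE : D = G *m T + d^-1 *: (c *m b) by rewrite -SE subrK.
have tb : (t / d) *: b = - (i * e) *: (w *m (G + T)).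
  have e3 : (e * (t * - (e / d))) *: b + (e * - i) *: (w *m (G + T)) = 0.
    have v3' : t *: E1 + - i *: (w *m (G + T)) = 0.
      by move: v3; rewrite mul_scalar_mx /E2 -scalemxAr.
    by rewrite -2!(scalerA e) -(scalerA t) -scalerDr v3' scaler0.
  have c1 : e * (t * - (e / d)) = - (t / d).
    by transitivity (- (e * e) * (t / d)); [ring|rewrite ee mulN1r].
  by move: e3; rewrite c1 scaleNr => /eqP; rewrite addrC subr_eq0 mulrN mulrC
    => /eqP.
have w0 : w = 0.
  have ieN1 : i * e != 1.
    apply/eqP => ie; have : (i * e) * (i * e) = -1 by rewrite mulrACA ee ii mulr1.
    by rewrite ie mulr1 => /eqP; rewrite -addr_eq0 (negPf two0).
  have unit1 (X : 'M[F]_m) : nilp (X - 1%:M) -> X - (i * e)%:M \in unitmx.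
    move=> nX; have -> : X - (i * e)%:M = (1 - i * e)%:M + (X - 1%:M).
      by rewrite raddfB [RHS]addrC addrA subrK.
    by apply: nilp_unit; rewrite // subr_eq0 eq_sym.
  have GTE : (G - (i * e)%:M) *m (T - (i * e)%:M) =
      G *m T - (i * e) *: (G + T) - 1%:M.
    rewrite mulmxBl !mulmxBr -scalar_mxM mulrACA ee ii mulr1 mul_mx_scalar.
    by rewrite mul_scalar_mx raddfN opprD opprK scalerDr opprD !addrA.
  have v2' : t *: b + (w *m (G *m T) - (d^-1 * (t * (d - 1))) *: b) - w = 0.
    move: v2; rewrite DE mulmxBr mulmxDr mulmx1 mul_scalar_mx addrA => <-.
    rewrite -scalemxAr (mulmxA w c) wcE mulNmx mul_scalar_mx scalerN.
    by rewrite scalerA.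
  have tE : t *: b = (t / d) *: b + (d^-1 * (t * (d - 1))) *: b.
    by rewrite -scalerDl; congr (_ *: _); field.
  have : w *m ((G - (i * e)%:M) *m (T - (i * e)%:M)) = 0.
    have -> : w *m ((G - (i * e)%:M) *m (T - (i * e)%:M)) =
        w *m (G *m T) - (i * e) *: (w *m (G + T)) - w.
      by rewrite GTE !mulmxBr mulmx1 -scalemxAr.
    rewrite -v2' tE -scaleNr -tb addrA (addrAC _ _ (w *m _)) addrK.
    by rewrite (addrC (w *m _)).
  have u2 := unit1 _ nG; have u3 := unit1 _ nT.
  move/(congr1 (mulmx^~ (invmx (T - (i * e)%:M) *m invmx (G - (i * e)%:M)))).
  by rewrite mul0mx !mulmxA mulmxK// mulmxK.
move: tb; rewrite w0 mul0mx scaler0 => /eqP; rewrite scaler_eq0 (negPf b0) orbF.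
rewrite mulf_eq0 invr_eq0 (negPf d0) orbF => /eqP t0.
by rewrite [lsubmx v]mx11_scalar -/t t0 raddf0.
Qed.

(* The eigenvalue carried by the first vector. *)
Let delta := i * e * d.

Let swp : 'M[F]_(m + m) := block_mx 0 1%:M 1%:M 0.
Let U : 'M[F]_(1 + (m + m)) :=
  block_mx d%:M (row_mx b E1) (col_mx c 0) (block_mx D E2 0 1%:M).

Lemma corner_reassoc : mxsim (block_mx D1 E 0 1%:M) U.
Proof.
have := @block_mxA _ 1 m m 1 m m d%:M b E1 c D E2 0 0 1%:M.
rewrite row_mx0 => /= UE; rewrite /U UE; exact: mxsim_cast.
Qed.

Lemma corner_inv : dsum (e%:M : 'M_1) swp *m dsum e%:M swp = 1%:M.
Proof. by rewrite -dsumM -scalar_mxM ee swapK dsum1. Qed.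

Lemma corner_similar : exists (B : 'cV[F]_(m + m)) (V : 'M[F]_(m + m)), nilp (V - 1%:M) /\
  mxsim (i *: (dsum (e%:M : 'M_1) swp *m U)) (block_mx delta%:M 0 B V).
Proof.
pose C := G + T; pose B : 'cV[F]_(m + m) := col_mx 0 (i *: c).
have NE : i *: (dsum (e%:M : 'M_1) swp *m U) =
    block_mx delta%:M (row_mx ((i * e) *: b) ((i * e) *: E1)) B
      (block_mx 0 i%:M (i *: D) C).
  rewrite /dsum mulmx_block !(mul0mx, addr0, add0r) -scalar_mxM.
  rewrite mul_scalar_mx mul_block_col mulmx_block.
  rewrite !(mulmx0, mul0mx, mul1mx, mulmx1, addr0, add0r).
  rewrite !scale_block_mx scale_scalar_mx scale_col_mx !scale_row_mx /E2 !scalerA.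
  have iN : i * - i = 1 by rewrite mulrN ii opprK.
  by rewrite mulrA !scaler0 scalemx1 iN scale1r.
have dE1 : delta *: (e *: E1) = - ((i * e) *: b).
  rewrite /E1 !scalerA -scaleNr; congr (_ *: _).
  by transitivity (- (e * e) * (i * e)); [rewrite /delta; field|rewrite ee mulN1r].
have cE1 : i *: D + (i * e) *: (c *m E1) = i *: (G *m T).
  rewrite -SE scalerBr; congr (_ + _); rewrite -scalemxAr !scalerA -scaleNr.
  congr (_ *: _); transitivity (- (e * e) * (i / d)); first ring.
  by rewrite ee mulN1r.
pose S : 'rV[F]_(m + m) := row_mx (e *: E1) 0.
have sim1 : mxsim (i *: (dsum (e%:M : 'M_1) swp *m U))
    (block_mx delta%:M 0 B (swap_step i (G *m T) C)).
  exists (block_mx 1%:M S 0 1%:M), (block_mx 1%:M (- S) 0 1%:M).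
  rewrite NE !mulmx_block !(mul0mx, mulmx0, mul1mx, mulmx1, addr0, add0r).
  rewrite addNr addrN -scalar_mx_block; split=> //; congr block_mx.
  - by rewrite /S /B mul_row_col mulmx0 mul0mx !addr0.
  - rewrite /S /swap_step mul_row_block !(mul0mx, mulmx0, addr0).
    rewrite mul_mx_scalar mul_scalar_mx scale_row_mx scaler0 add_row_mx add0r.
    by rewrite dE1 addNr -(scalerA i).
  - rewrite /S /B mul_col_row !(mul0mx, mulmx0) add_block_mx !(addr0, add0r).
    by rewrite -scalemxAl -scalemxAr scalerA addrC cE1.
have QP := shear_inv (i *: T); have PQ := shear_inv (- (i *: T)).
rewrite opprK in PQ.
exists (block_mx 1%:M 0 (i *: T) 1%:M *m B), (block_mx T i%:M 0 G); split.
  rewrite [X in _ - X]scalar_mx_block opp_block_mx add_block_mx !subr0.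
  exact: nilp_block.
apply: mxsim_trans sim1 _.
exact: (lblock_similar _ _ PQ QP (swap_step_shear ii G T)).
Qed.

Lemma corner_unit : delta = 1 -> inv_graded_product (i *: block_mx D1 E 0 1%:M).
Proof.
move=> delta1; apply: inv_graded_product_similar
  (mxsim_scale i corner_reassoc) _.
apply: (inv_graded_product_left corner_inv).
have [B [V [nV NV]]] := corner_similar; apply: graded_product_similar NV _.
rewrite delta1 -[block_mx _ _ _ _](subrK 1%:M) addrC.
apply: graded_product_unipotent.
rewrite [X in _ - X]scalar_mx_block opp_block_mx add_block_mx subrr !subr0.
by apply: nilp_lblock nV; exact: nilp0.
Qed.

Lemma corner_pad : delta = i \/ delta = - i ->
  inv_graded_product (i *: dsum (block_mx D1 E 0 1%:M) (1%:M : 'M_1)).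
Proof.
move=> di; apply: inv_graded_product_similar
  (mxsim_scale i (dsum_similar corner_reassoc (mxsim_refl _))) _.
have [f ff fd] : exists2 f, f * f = 1 & i * f = - delta.
  case: di => ->; first by exists (-1); rewrite ?mulrNN ?mulr1 ?mulrN1.
  by exists 1; rewrite ?mulr1 ?opprK.
apply: (@inv_graded_product_left _ (dsum (dsum e%:M swp) f%:M)).
  by rewrite -dsumM corner_inv -scalar_mxM ff dsum1.
rewrite -dsumM dsumZ mulmx1 scale_scalar_mx fd.
have [B [V [nV NV]]] := corner_similar.
have delta1 : 1 - delta != 0.
  have i1 : i != 1.
    by apply: contra two0 => /eqP i1; move: ii; rewrite i1 mulr1 => /eqP;
      rewrite -addr_eq0.
  case: di => ->; rewrite subr_eq0 eq_sym//.
  by apply: contra two0 => /eqP i1'; move: ii; rewrite -mulrNN i1' mulr1 => /eqP;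
      rewrite -addr_eq0.
have Vu : V - delta%:M \in unitmx.
  have -> : V - delta%:M = (1 - delta)%:M + (V - 1%:M).
    by rewrite raddfB [RHS]addrC addrA subrK.
  exact: nilp_unit.
have split_V : mxsim (block_mx delta%:M 0 B V) (dsum (delta%:M : 'M_1) V).
  apply: (@split_lblock F _ _ delta%:M B V (- (invmx (V - delta%:M) *m B))).
  have := mulKVmx Vu B; set Z := invmx _ *m B.
  rewrite mulmxBl mul_scalar_mx mulmxN => <-.
  by rewrite mulNmx mul_mx_scalar addrAC subrr sub0r.
apply: graded_product_similar.
  exact: dsum_similar (mxsim_trans NV split_V) (mxsim_refl _).
have : mxsim (dsum (dsum (delta%:M : 'M_1) V) ((- delta)%:M : 'M_1))
    (dsum (dsum (delta%:M : 'M_1) ((- delta)%:M : 'M_1)) V).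
  apply: mxsim_trans (mxsim_sym (dsumA_similar _ _ _)) _.
  apply: mxsim_trans (dsumA_similar _ _ _).
  by apply: dsum_similar (dsumC_similar _ _); exact: mxsim_refl.
move/graded_product_similar; apply; apply: graded_product_dsum.
  have gi := inverse_scalars_graded ii two0.
  case: di => ->; last by rewrite opprK.
  exact: graded_product_similar (dsumC_similar _ _) gi.
rewrite -[V](subrK 1%:M) addrC; exact: graded_product_unipotent.
Qed.

End Corner.

(** The sign of the involution on the first vector gives the leftover eigenvalue
    [i e det D], which is [i] or [-i] for [det D = 1] or [-1], and can be made
    equal to [1] for [det D = i] or [-i]. *)
Lemma realizable_nonscalar m (D : 'M[F]_(1 + m)) :
  ~~ is_scalar_mx D -> \det D ^+ 4 = 1 -> realizable D.
Proof.
move=> Dn d4; set d := \det D in d4.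
have d0 : d != 0.
  by apply/eqP => d0; move/eqP: d4; rewrite d0 expr0n eq_sym oner_eq0.
have Du : D \in unitmx by rewrite unitmxE unitfE.
have [b [c [D' [b0 DE Sn]]]] := schur_corner Dn Du d0.
have S1 : \det (D' - d^-1 *: (c *m b)) = 1.
  by apply: (mulfI d0); rewrite -det_schur// -(mxsim_det DE) mulr1.
have [|G [T [nG nT SE]]] := unipotent_factors S1.
  have [m1|m1] := leqP m 1; first by move=> _; exact: scalar_det1.
  by move=> Ss; move: (Sn m1); rewrite Ss.
apply: realizable_similar DE _.
have cp e ee := @corner_pad m d e b c D' G T d0 ee SE nG nT.
have cu e ee := @corner_unit m d e b c D' G T d0 ee SE nG nT.
have rf e ee := @corner_row_free m d e b c D' G T d0 ee b0 SE nG nT.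
have NN : -1 * -1 = 1 :> F by rewrite mulrNN mulr1.
have [] := fourth_root_cases ii d4 => dE.
- apply: realizable_pad (rf 1 (mulr1 1)) _; apply: cp (mulr1 1) _.
  by left; rewrite dE !mulr1.
- apply: realizable_pad (rf 1 (mulr1 1)) _; apply: cp (mulr1 1) _.
  by right; rewrite dE mulr1 mulrN1.
- exists m, (col_mx (- (-1 / d) *: b) (- i *: (G + T))).
  split; first exact: rf NN.
  by apply: cu NN _; rewrite dE mulrN1 mulNr ii opprK.
- exists m, (col_mx (- (1 / d) *: b) (- i *: (G + T))).
  split; first exact: rf (mulr1 1).
  by apply: cu (mulr1 1) _; rewrite dE mulr1 mulrN ii opprK.
Qed.

Lemma realizable_fourth r (D : 'M[F]_r) : \det D ^+ 4 = 1 -> realizable D.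
Proof.
have [/is_scalar_mxP[x ->]|] := boolP (is_scalar_mx D).
  exact: realizable_scalar.
case: r D => [|r] D; last exact: (@realizable_nonscalar r).
by case/is_scalar_mxP; exists 0; apply/matrixP => -[].
Qed.

End MatrixTheorem.

(** * Endomorphisms defined on a basis *)
Section Bases.
Variables (F : fieldType) (V : lmodType F).

Definition End_of (f : V -> V) (lf : linear f) : End V :=
  HB.pack f (GRing.isLinear.Build F V V *:%R f lf).

(** The list [s] may have repeated indices, and a family is free when all the
    accumulated coefficients [coef s j] of a vanishing combination are zero:
    lists can then be concatenated and scaled without normalizing them. *)
Definition comb (J : Type) (b : J -> V) (s : seq (F * J)) : V :=
  \sum_(p <- s) p.1 *: b p.2.

Definition coef (J : eqType) (s : seq (F * J)) (j : J) : F :=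
  \sum_(p <- s | p.2 == j) p.1.

Definition basis (J : eqType) (b : J -> V) : Prop :=
  (forall v, exists s, v = comb b s) /\
  (forall s, comb b s = 0 -> forall j, coef s j = 0).

Lemma comb_cat (J : Type) (b : J -> V) s t :
  comb b (s ++ t) = comb b s + comb b t.
Proof. by rewrite /comb big_cat. Qed.

Definition scale_seq (J : Type) (a : F) (s : seq (F * J)) :=
  [seq (a * p.1, p.2) | p <- s].

Lemma comb_scale (J : Type) (b : J -> V) a s :
  comb b (scale_seq a s) = a *: comb b s.
Proof.
by rewrite /comb big_map scaler_sumr; apply: eq_bigr => p _; rewrite scalerA.
Qed.

Lemma comb_linear (J : Type) (b : J -> V) (f : End V) s :
  f (comb b s) = comb (f \o b) s.
Proof.
rewrite /comb (linear_sum (f : {linear V -> V})); apply: eq_bigr => p _.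
exact: (linearZ_LR (f : {linear V -> V})).
Qed.

Lemma comb_coef (J : eqType) (b : J -> V) s :
  comb b s = \sum_(j <- undup (map snd s)) coef s j *: b j.
Proof.
under [RHS]eq_bigr do rewrite scaler_suml.
rewrite (exchange_big_dep predT)//= /comb; apply: eq_big_seq => p ps.
have pU : p.2 \in undup (map snd s) by rewrite mem_undup map_f.
under eq_bigl do rewrite eq_sym.
by rewrite -big_filter (filter_pred1_uniq (undup_uniq _) pU) big_seq1.
Qed.

Lemma basis_inj (J : eqType) (b g : J -> V) s t : basis b ->
  comb b s = comb b t -> comb g s = comb g t.
Proof.
move=> [_ bfree] st; apply/eqP; rewrite -subr_eq0 -scaleN1r -comb_scale -comb_cat.
rewrite comb_coef big1 // => j _; rewrite bfree ?scale0r//.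
by rewrite comb_cat comb_scale st scaleN1r subrr.
Qed.

Lemma basis_extend (J : eqType) (b g : J -> V) : basis b ->
  exists f : End V, forall j, f (b j) = g j.
Proof.
move=> bb; have [/choice[sV sVE] _] := bb.
have lin : linear (fun v => comb g (sV v)).
  move=> a u v; rewrite -comb_scale -comb_cat; apply: (basis_inj _ bb).
  by rewrite comb_cat comb_scale -!sVE.
exists (End_of lin) => j /=.
rewrite (basis_inj (t := [:: (1, j)]) g bb) /comb; last first.
  by rewrite -/(comb _ _) -sVE big_seq1 scale1r.
by rewrite big_seq1 scale1r.
Qed.

Lemma basis_ext (J : eqType) (b : J -> V) (f g : End V) : basis b ->
  (forall j, f (b j) = g (b j)) -> f = g.
Proof.
move=> [bgen _] fg; apply: EndP => v; have [s ->] := bgen v.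
by rewrite !comb_linear; apply: eq_bigr => p _; rewrite /= fg.
Qed.

Lemma coef_cat (J : eqType) (s t : seq (F * J)) j :
  coef (s ++ t) j = coef s j + coef t j.
Proof. by rewrite /coef big_cat. Qed.

Lemma coef_map (J J' : eqType) (h : J' -> J) (s : seq (F * J')) j : injective h ->
  coef [seq (p.1, h p.2) | p <- s] (h j) = coef s j.
Proof.
move=> hinj; rewrite /coef big_map; apply: eq_bigl => p.
by rewrite /= (inj_eq hinj).
Qed.

Lemma comb_map (J J' : Type) (h : J' -> J) (b : J -> V) (s : seq (F * J')) :
  comb b [seq (p.1, h p.2) | p <- s] = comb (b \o h) s.
Proof. by rewrite /comb big_map. Qed.

Lemma basis_reindex (J J' : eqType) (b : J -> V) (h : J' -> J) :
  bijective h -> basis b -> basis (b \o h).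
Proof.
move=> [k hk kh] [bgen bfree]; split=> [v|s s0 j].
  have [s ->] := bgen v; exists [seq (p.1, k p.2) | p <- s].
  by rewrite comb_map; apply: eq_bigr => p _; rewrite /= kh.
rewrite -(coef_map s j (can_inj hk)) bfree// comb_map//.
Qed.

Section Model.
Variables (n : nat) (K : eqType) (b : 'I_n + K * 'I_2 -> V).
Hypothesis bb : basis b.

Definition model_image (A : 'M[F]_n) (B : 'M[F]_2) (j : 'I_n + K * 'I_2) : V :=
  match j with
  | inl j => \sum_k A k j *: b (inl k)
  | inr (x, j) => \sum_k B k j *: b (inr (x, k))
  end.

Lemma model_exists : exists f : 'M[F]_n -> 'M[F]_2 -> End V,
  forall A B j, f A B (b j) = model_image A B j.
Proof.
have /choice[f fE] : forall AB : 'M[F]_n * 'M[F]_2,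
    exists f : End V, forall j, f (b j) = model_image AB.1 AB.2 j.
  by move=> AB; exact: basis_extend.
by exists (fun A B => f (A, B)) => A B j; rewrite fE.
Qed.

(** A basis made of [n] vectors and of pairs makes ['M_n] and ['M_2] act on [V],
    the latter on all the pairs simultaneously. *)
Lemma model_inv_graded (A : 'M[F]_n) (B : 'M[F]_2) (u : End V) :
    inv_graded_product A -> inv_graded_product B ->
    (forall j, u (b j) = model_image A B j) ->
  inv_graded_product u.
Proof.
move=> gA gB uE; have [f fE] := model_exists.
have -> : u = f A B by apply: (basis_ext bb) => j; rewrite uE fE.
have colE m (M : 'M[F]_m) (e : 'I_m -> V) (g : End V) j :
    g (\sum_k M k j *: e k) = \sum_k M k j *: g (e k).
  rewrite (linear_sum (g : {linear V -> V})); apply: eq_bigr => k _.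
  exact: (linearZ_LR (g : {linear V -> V})).
have mulE m (M N : 'M[F]_m) (e : 'I_m -> V) j :
    \sum_k (M * N) k j *: e k =
    \sum_k N k j *: (\sum_l M l k *: e l).
  under [RHS]eq_bigr do rewrite scaler_sumr.
  rewrite exchange_big /=; apply: eq_bigr => k _.
  rewrite -mulmxE mxE scaler_suml; apply: eq_bigr => l _.
  by rewrite scalerA mulrC.
have oneE m (e : 'I_m -> V) j : \sum_k (1 : 'M[F]_m) k j *: e k = e j.
  rewrite (bigD1 j)//= mxE eqxx scale1r big1 ?addr0// => k kj.
  by rewrite mxE (negPf kj) scale0r.
have addE m (M N : 'M[F]_m) (e : 'I_m -> V) j : \sum_k (M + N) k j *: e k =
    \sum_k M k j *: e k + \sum_k N k j *: e k.
  by rewrite -big_split; apply: eq_bigr => k _; rewrite mxE scalerDl.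
apply: (inv_graded_product_map2 _ _ _ gA gB) => [|M M' N N'|M M' N N'].
- by apply: (basis_ext bb) => -[j|[x j]]; rewrite fE /= oneE.
- apply: (basis_ext bb) => -[j|[x j]]; rewrite End_mulE !fE /= colE mulE.
    by apply: eq_bigr => k _; rewrite fE.
  by apply: eq_bigr => k _; rewrite fE.
- by apply: (basis_ext bb) => -[j|[x j]]; rewrite End_addE !fE /= addE.
Qed.

End Model.

End Bases.

(** * A complement with a basis made of pairs *)

Lemma hilbert_hotel (X : eqType) (c : nat -> X) : injective c ->
  exists h : X -> option X, bijective h.
Proof.
move=> cinj.
pose h x := if pselect (exists n, x = c n) is left ex then
  (if projT1 (cid ex) is n.+1 then Some (c n) else None) else Some x.
pose k y := if y is Some x then
  (if pselect (exists n, x = c n) is left ex then c (projT1 (cid ex)).+1 else x)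
  else c 0%N.
have idx n (ex : exists m, c n = c m) : projT1 (cid ex) = n.
  by case: cid => m /= /cinj.
have hc n : h (c n) = if n is m.+1 then Some (c m) else None.
  by rewrite /h; case: pselect => [ex|[]]; [rewrite idx|exists n].
have kc n : k (Some (c n)) = c n.+1.
  by rewrite /k; case: pselect => [ex|[]]; [rewrite idx|exists n].
have hx x : ~ (exists n, x = c n) -> h x = Some x.
  by move=> nx; rewrite /h; case: pselect.
have kx x : ~ (exists n, x = c n) -> k (Some x) = x.
  by move=> nx; rewrite /k; case: pselect.
exists h; exists k => [x|[x|]]; last exact: hc.
- have [[[|n] ->]|nx] := pselect (exists n, x = c n); rewrite ?hc ?kc//.
  by rewrite hx// kx.
- have [[n ->]|nx] := pselect (exists n, x = c n); first by rewrite kc hc.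
  by rewrite kx// hx.
Qed.

Section Pairing.
Variables (F : fieldType) (V : lmodType F).
Variables (n : nat) (e : 'I_n -> V) (w : End V).
Hypothesis efree : lin_indep e.
Hypothesis ew : forall v, exists c : 'I_n -> F, w (v - \sum_j c j *: e j) = 0.
Hypothesis Vinf : infinite_dimensional V.

(* The pairs are taken in [V * V] itself, so that the sets of pairs to which
   Zorn's lemma applies share one index type. *)
Let J : eqType := ('I_n + (V * V) * 'I_2)%type.

Let fam (j : J) : V :=
  match j with
  | inl k => e k
  | inr (p, k) => if k == 0 then p.1 else p.2
  end.

Let inside (P : set (V * V)) (j : J) : Prop :=
  if j is inr (p, _) then P p else True.

Let over (P : set (V * V)) (s : seq (F * J)) : Prop :=
  forall p, p \in s -> inside P p.2.

Let admissible (P : set (V * V)) : Prop :=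
  (forall p, P p -> w p.1 = 0 /\ w p.2 = 0) /\
  (forall s, over P s -> comb fam s = 0 -> forall j, coef s j = 0).

Let span (P : set (V * V)) (v : V) : Prop :=
  exists2 s, over P s & v = comb fam s.

Let spanD P u v : span P u -> span P v -> span P (u + v).
Proof.
move=> [s sP ->] [t tP ->]; exists (s ++ t); last by rewrite comb_cat.
by move=> p; rewrite mem_cat => /orP[/sP|/tP].
Qed.

Let spanZ P a v : span P v -> span P (a *: v).
Proof.
move=> [s sP ->]; exists (scale_seq a s); last by rewrite comb_scale.
by move=> p /mapP[q qs ->]; exact: (sP q qs).
Qed.

Let span_fam P j : inside P j -> span P (fam j).
Proof.
move=> jP; exists [:: (1, j)]; last by rewrite /comb big_seq1 scale1r.
by move=> p; rewrite inE => /eqP->.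
Qed.

Let span0 P : span P 0.
Proof. by exists [::]; rewrite // /comb big_nil. Qed.

Let span_sum P (I : finType) (v : I -> V) :
  (forall k, span P (v k)) -> span P (\sum_k v k).
Proof. by move=> vP; elim/big_ind: _; [exact: span0|exact: spanD|by []]. Qed.

Let span_e P (c : 'I_n -> F) : span P (\sum_j c j *: e j).
Proof. by apply: span_sum => k; apply: spanZ; exact: (@span_fam P (inl k)). Qed.

Let over_chain (C : set (set (V * V))) X0 s : total_on C subset -> C X0 ->
  over (\bigcup_(X in C) X)%classic s -> exists2 X, C X & over X s.
Proof.
move=> Ctot CX0; elim: s => [|p s IH] sP; first by exists X0.
have [|X CX sX] := IH; first by move=> q qs; apply: sP; rewrite inE qs orbT.
have := sP p (mem_head _ _).
case pE : p.2 => [k|[q k]] /=.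
  move=> _; exists X => // q; rewrite inE => /predU1P[->|/sX//].
  by rewrite pE.
move=> [Y CY Yq]; have [XY|YX] := Ctot _ _ CX CY.
  exists Y => // q'; rewrite inE => /predU1P[->|/sX]; first by rewrite pE.
  by case: (q'.2) => // -[? ?] /XY.
exists X => // q'; rewrite inE => /predU1P[->|/sX//].
by rewrite pE; exact: YX.
Qed.

Let admissible0 : admissible set0.
Proof.
split=> // s sP s0.
have sinl p : p \in s -> exists k, p.2 = inl k.
  by move=> /sP; case: (p.2) => [k|[? ?]]//; exists k.
have c0 : forall k : 'I_n, coef s (inl k) = 0.
  apply: (efree (c := fun k => coef s (inl k))); rewrite -[RHS]s0 /comb.
  under eq_bigr do rewrite scaler_suml.
  rewrite (exchange_big_dep predT)//= !big_seq; apply: eq_bigr => p ps.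
  have [k pk] := sinl p ps; rewrite pk (big_pred1 k) ?pk// => k'.
move=> [k|q]; first exact: c0.
rewrite /coef big_seq_cond big1// => p /andP[/sinl[k ->]].
by [].
Qed.

Let exists_maximal : exists P, admissible P /\
  forall B : set (V * V), (P `<` B)%classic -> ~ admissible B.
Proof.
apply: Zorn_bigcup => C CA Ctot.
have [[X0 CX0]|C0] := pselect (exists X, C X); last first.
  suff -> : (\bigcup_(X in C) X)%classic = set0 by exact: admissible0.
  by rewrite -subset0 => p [X CX _]; apply: C0; exists X.
split=> [p [X /CA[Xw _] /Xw//]|s sC s0].
by have [X /CA[_ Xf] sX] := over_chain Ctot CX0 sC; exact: Xf.
Qed.

(* Two vectors of the kernel that are independent modulo the span would form an
   additional pair. *)
Let maximal_codim P z z' :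
    (forall B : set (V * V), (P `<` B)%classic -> ~ admissible B) ->
    admissible P -> w z = 0 -> w z' = 0 -> ~ span P z ->
  exists a, span P (z' - a *: z).
Proof.
move=> Pmax [Pw Pfree] wz wz' zP; apply: contrapT => z'P.
have PN : ~ P (z, z') by move=> Pz; apply: zP; exact: (@span_fam P (inr ((z, z'), 0))).
pose B : set (V * V) := (P `|` [set (z, z')])%classic.
apply: (Pmax B); first by split=> [p|BP]; [left|apply: PN; apply: BP; right].
split=> [p [/Pw//|->//]|s sB s0].
pose new (j : J) := if j is inr (p, _) then p == (z, z') else false.
pose s0' := [seq p <- s | ~~ new p.2].
pose a := coef s (inr ((z, z'), 0)); pose a' := coef s (inr ((z, z'), 1)).
have s0P : over P s0'.
  move=> p; rewrite mem_filter => /andP[pn /sB].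
  case: (p.2) pn => [//|[q k]] /= qz [//|qE].
  by rewrite qE eqxx in qz.
have part j : \sum_(p <- s | p.2 == j) p.1 *: fam p.2 = coef s j *: fam j.
  by rewrite /coef scaler_suml; apply: eq_bigr => p /eqP->.
have newE j : new j = (j == inr ((z, z'), 0)) || (j == inr ((z, z'), 1)).
  case: j => [//|[q k]] /=.
  have inrE (k' : 'I_2) : (inr (q, k) == inr ((z, z'), k') :> J) =
      (q == (z, z')) && (k == k') by [].
  rewrite !inrE -andb_orr; case: (q == _) => //=.
  by case: k {inrE} => -[|[|]].
have sE : comb fam s = comb fam s0' + (a *: z + a' *: z').
  rewrite /comb big_filter (bigID (fun p => ~~ new p.2)) /=; congr (_ + _).
  rewrite -(part (inr ((z, z'), 0))) -(part (inr ((z, z'), 1))).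
  rewrite (bigID (fun p => p.2 == inr ((z, z'), 0))) /=; congr (_ + _).
    by apply: eq_bigl => p; rewrite negbK newE andbC andb_idr// => ->.
  apply: eq_bigl => p; rewrite negbK newE; case: eqP => [->|] /=.
    by apply/esym/negbTE/eqP; case.
  by rewrite andbT.
have coefE j : ~~ new j -> coef s j = coef s0' j.
  move=> jn; rewrite /coef big_filter_cond; apply: eq_bigl => p.
  by case: eqP => [->|]; rewrite ?jn ?andbF.
move: (s0); rewrite sE => sz.
have combE : comb fam s0' = - (a *: z + a' *: z').
  by apply/eqP; rewrite -addr_eq0 sz.
have a'0 : a' = 0.
  apply: contrapT => /eqP a'0; apply: z'P; exists (- (a'^-1 * a)).
  have -> : z' - - (a'^-1 * a) *: z = - a'^-1 *: comb fam s0'.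
    rewrite combE !scaleNr scalerN !opprK scalerDr !scalerA mulVf// scale1r.
    by rewrite addrC.
  by apply: spanZ; exists s0'.
rewrite a'0 scale0r addr0 in combE.
have a0 : a = 0.
  apply: contrapT => /eqP a0; apply: zP.
  have -> : z = - a^-1 *: comb fam s0'.
    by rewrite combE scaleNr scalerN opprK scalerA mulVf// scale1r.
  by apply: spanZ; exists s0'.
move=> j; have [|jn] := boolP (new j).
  by rewrite newE => /orP[] /eqP->.
by rewrite coefE// Pfree// combE a0 scale0r oppr0.
Qed.

Let finitely_spanned (L : seq V) : exists v, forall c : 'I_(size L) -> F,
  v <> \sum_k c k *: L`_k.
Proof.
apply: contrapT => nv; apply: Vinf; exists (size L), (fun k => L`_k) => v.
apply: contrapT => vL; apply: nv; exists v => c vE; apply: vL.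
by exists c.
Qed.

Let listed (L : seq V) (v : V) : Prop :=
  exists c : 'I_(size L) -> F, v = \sum_k c k *: L`_k.

Let listedD L u v : listed L u -> listed L v -> listed L (u + v).
Proof.
move=> [c ->] [d ->]; exists (fun k => c k + d k); rewrite -big_split /=.
by apply: eq_bigr => k _; rewrite scalerDl.
Qed.

Let listedZ L a v : listed L v -> listed L (a *: v).
Proof.
move=> [c ->]; exists (fun k => a * c k); rewrite scaler_sumr.
by apply: eq_bigr => k _; rewrite scalerA.
Qed.

Let listed_mem (L : seq V) v : v \in L -> listed L v.
Proof.
move=> /(nthP 0)[k kL <-]; exists (fun l => (l == Ordinal kL)%:R).
rewrite (bigD1 (Ordinal kL))//= eqxx scale1r big1 ?addr0// => l /negPf->.
by rewrite scale0r.
Qed.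

Let maximal_infinite P z : (forall v, exists a, span P (v - a *: z)) ->
  infinite_set P.
Proof.
move=> Pz /finite_seqP[p Pp].
pose L := z :: [seq e k | k <- enum 'I_n] ++ map fst p ++ map snd p.
have [v vL] := finitely_spanned L.
have [a [s sP vE]] := Pz v.
suff [c vE'] : listed L v by exact: vL vE'.
rewrite -(subrK (a *: z) v) vE; apply: listedD; last first.
  by apply/listedZ/listed_mem; rewrite inE eqxx.
rewrite /comb big_seq; elim/big_ind: _ => [||q /sP].
- by rewrite -(scale0r z); apply/listedZ/listed_mem; rewrite inE eqxx.
- exact: listedD.
move=> qP; apply/listedZ/listed_mem; move: qP.
case: (q.2) => [k _|[t k]] /=.
  by rewrite inE mem_cat map_f ?orbT// mem_enum.
rewrite Pp /= => tp; rewrite inE !mem_cat.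
by case: ifP => _; rewrite map_f ?orbT.
Qed.

(** A maximal admissible set of pairs spans everything up to at most one vector
    of the kernel.  There are infinitely many pairs, so this vector is absorbed
    by renumbering them. *)
Lemma pairing_basis : exists (K : eqType) (b : K * 'I_2 -> V),
  (forall x, w (b x) = 0) /\
  basis (fun j : 'I_n + K * 'I_2 => match j with inl k => e k | inr x => b x end).
Proof.
have [P [Padm Pmax]] := exists_maximal; have [Pw Pfree] := Padm.
pose K : eqType := set_type P.
pose val2 (x : K * 'I_2) : (V * V) * 'I_2 := (\val x.1, x.2).
pose b (x : K * 'I_2) : V := fam (inr (val2 x)).
have bw x : w (b x) = 0.
  by have [w1 w2] := Pw _ (set_mem (valP x.1)); rewrite /b /=; case: ifP.
pose toJ (j : 'I_n + K * 'I_2) : J :=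
  match j with inl k => inl k | inr x => inr (val2 x) end.
have toJ_inj : injective toJ.
  move=> [k|[p k]] [k'|[p' k']]//= [] => [->//|/val_inj-> ->//].
have toJ_in j : inside P (toJ j).
  by case: j => [//|[p k]] /=; exact: set_mem (valP p).
have lift s : over P s -> exists t, s = [seq (p.1, toJ p.2) | p <- t].
  elim: s => [_|p s IH ps]; first by exists [::].
  have [|t ->] := IH; first by move=> q qs; apply: ps; rewrite inE qs orbT.
  have : inside P p.2 by apply: ps; rewrite mem_head.
  case: p {ps} => a [k _|[q k] /= Pq]; first by exists ((a, inl k) :: t).
  by exists ((a, inr (SigSub (mem_set Pq) : K, k)) :: t).
pose bK (j : 'I_n + K * 'I_2) := match j with inl k => e k | inr x => b x end.
have combK t : comb bK t = comb fam [seq (p.1, toJ p.2) | p <- t].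
  by rewrite comb_map; apply: eq_bigr => -[y [k|x]] _.
have Kfree t : comb bK t = 0 -> forall j, coef t j = 0.
  rewrite combK => t0 j; rewrite -(coef_map t j toJ_inj) Pfree// => p.
  by move=> /mapP[q _ ->]; exact: toJ_in.
have Kgen v : span P v -> exists t, v = comb bK t.
  by move=> [s /lift[t ->] ->]; exists t; rewrite combK.
have [allP|] := pselect (forall v, span P v).
  by exists K, b; split=> //; split=> [v|]; [exact/Kgen/allP|exact: Kfree].
move=> /existsNP[v0 v0P]; have [c0 v0w] := ew v0.
pose z := v0 - \sum_j c0 j *: e j.
have zP : ~ span P z.
  move=> zP; apply: v0P; rewrite -(subrK (\sum_j c0 j *: e j) v0).
  exact: spanD zP (span_e _ _).
have Pz v : exists a, span P (v - a *: z).
  have [c vw] := ew v; have [a] := maximal_codim Pmax Padm v0w vw zP.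
  exists a; rewrite -(subrK (\sum_j c j *: e j) v) addrAC.
  by apply: spanD (span_e _ _).
have /infiniteP/card_leP[f] := maximal_infinite Pz.
pose c k : K * 'I_2 := (f (SigSub (mem_set (I : [set: nat]%classic k))), 0).
have cinj : injective c.
  move=> k l [] fkl; have := @inj _ _ _ f _ _ (in_setT _) (in_setT _) fkl.
  by move/(congr1 val).
have [h hbij] := hilbert_hotel cinj.
pose bz (j : 'I_n + option (K * 'I_2)) :=
  match j with inl k => e k | inr (Some x) => b x | inr None => z end.
pose drop_z (p : F * ('I_n + option (K * 'I_2))) :=
  match p.2 with
  | inl k => Some (p.1, inl k : 'I_n + K * 'I_2)
  | inr (Some x) => Some (p.1, inr x)
  | inr None => None
  end.
have combz t : comb bz t = comb bK (pmap drop_z t) + coef t (inr None) *: z.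
  elim: t => [|[y j] t IH].
    by rewrite /comb /coef !big_nil scale0r addr0.
  rewrite -cat1s comb_cat coef_cat IH scalerDl {1}/comb big_seq1 /=.
  rewrite [coef [:: _] _]/coef big_mkcond big_seq1.
  case: j => [k|[x|]] /=; rewrite ?scale0r ?add0r; last by rewrite addrCA.
    by rewrite -cat1s comb_cat {2}/comb big_seq1 addrA.
  by rewrite -cat1s comb_cat {2}/comb big_seq1 addrA.
pose emb (j : 'I_n + K * 'I_2) : 'I_n + option (K * 'I_2) :=
  match j with inl k => inl k | inr x => inr (Some x) end.
have coefz t j : coef t (emb j) = coef (pmap drop_z t) j.
  elim: t => [|[y j'] t IH]; first by rewrite /coef !big_nil.
  rewrite -cat1s coef_cat IH [coef [:: _] _]/coef big_mkcond big_seq1 /=.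
  by case: j' => [k|[x|]] /=; rewrite -?[_ :: pmap _ _]cat1s ?coef_cat;
    rewrite ?[coef [:: _] _]/coef ?(big_mkcond (fun p => p.2 == j)) ?big_seq1;
    case: j {IH} => [?|?]; rewrite ?add0r.
have bzB : basis bz.
  split=> [v|t t0].
    have [y /Kgen[t vE]] := Pz v.
    exists ((y, inr None) :: [seq (p.1, emb p.2) | p <- t]).
    rewrite -cat1s comb_cat {1}/comb big_seq1 /= comb_map.
    rewrite -(subrK (y *: z) v) vE addrC; congr (_ + _).
    by apply: eq_bigr => -[? [?|?]] _.
  move: t0; rewrite combz; have [y0|y0] := eqVneq (coef t (inr None)) 0 => t0.
    rewrite y0 scale0r addr0 in t0.
    move=> [k|[x|//]]; first by rewrite (coefz t (inl k)) Kfree.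
    by rewrite (coefz t (inr x)) Kfree.
  case: zP; exists [seq (p.1, toJ p.2) | p <-
    scale_seq (- (coef t (inr None))^-1) (pmap drop_z t)].
    by move=> p /mapP[q _ ->]; exact: toJ_in.
  rewrite -combK comb_scale; move/eqP: t0; rewrite addr_eq0 => /eqP->.
  by rewrite scaleNr scalerN opprK scalerA mulVf// scale1r.
pose b' x := if h x is Some y then b y else z.
exists K, b'; split=> [x|]; first by rewrite /b'; case: (h x).
pose H (j : 'I_n + K * 'I_2) : 'I_n + option (K * 'I_2) :=
  match j with inl k => inl k | inr x => inr (h x) end.
have Hbij : bijective H.
  have [g hg gh] := hbij.
  exists (fun j => match j with inl k => inl k | inr y => inr (g y) end).
    by case=> [//|x] /=; rewrite hg.
  by case=> [//|x] /=; rewrite gh.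
have := basis_reindex Hbij bzB; congr basis; apply: funext => -[//|x] /=.
by rewrite /b'; case: (h x).
Qed.

End Pairing.

(** * The theorem *)
Section Assembly.
Variables (F : fieldType) (V : lmodType F).
Hypothesis Vinf : infinite_dimensional V.

(** The kernel has finite codimension, so it contains arbitrarily many vectors
    that are independent modulo a given finite-dimensional subspace. *)
Lemma kernel_independent p (h : 'I_p -> V) (w : End V) :
    (forall v, exists c : 'I_p -> F, w (v - \sum_k c k *: h k) = 0) ->
  forall N, exists z : nat -> V, (forall k, w (z k) = 0) /\
    forall (x : 'I_p -> F) (d : nat -> F),
      \sum_k x k *: h k + \sum_(k < N) d k *: z k = 0 ->
      forall k, (k < N)%N -> d k = 0.
Proof.
move=> hw; elim=> [|N [z [wz zfree]]].
  by exists (fun=> 0); split=> // k; exact: (linear0 (w : {linear V -> V})).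
have [v [wv vN]] : exists v, w v = 0 /\ forall (x : 'I_p -> F) (d : nat -> F),
    v <> \sum_k x k *: h k + \sum_(k < N) d k *: z k.
  apply: contrapT => nv; apply: Vinf.
  exists (p + N)%N, (fun k : 'I_(p + N) =>
    match fintype.split k with inl k => h k | inr k => z k end).
  move=> v; have [c vw] := hw v.
  have [x [d vE]] : exists x d, v - \sum_k c k *: h k =
      \sum_k x k *: h k + \sum_(k < N) d k *: z k.
    apply: contrapT => nv'; apply: nv; exists (v - \sum_k c k *: h k).
    by split=> // x d vE; apply: nv'; exists x, d.
  exists (fun k : 'I_(p + N) =>
    match fintype.split k with inl k => c k + x k | inr k => d k end).
  rewrite big_split_ord /=.
  under eq_bigr do rewrite (unsplitK (inl _ : 'I_p + 'I_N)) scalerDl.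
  under [X in _ = _ + X]eq_bigr do rewrite (unsplitK (inr _ : 'I_p + 'I_N)).
  by rewrite big_split /= -addrA -vE addrC subrK.
exists (fun k => if (k < N)%N then z k else v); split=> [k|x d].
  by case: ifP.
rewrite big_ord_recr /= ltnn; under [X in _ + (X + _)]eq_bigr do rewrite ltn_ord.
rewrite addrA => xd0.
have dN : d N = 0.
  apply: contrapT => /eqP dN.
  pose a := - (d N)^-1; apply: (vN (fun k => a * x k) (fun k => a * d k)).
  under eq_bigr do rewrite -scalerA; rewrite -scaler_sumr.
  under [X in _ = _ + X]eq_bigr do rewrite -scalerA.
  rewrite -scaler_sumr -scalerDr; move/eqP: xd0; rewrite addr_eq0 => /eqP->.
  by rewrite /a scaleNr scalerN opprK scalerA mulVf// scale1r.
move: xd0; rewrite dN scale0r addr0 => /zfree xd0 k.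
by rewrite ltnS leq_eqVlt => /predU1P[->//|/xd0].
Qed.

(** The additional vectors [g j] are combinations, with coefficients in [E], of
    preimages [v a] of the basis [f] of the image; adding [z j] from the kernel
    of [w] makes them independent.  On the complement [u] is the identity, and
    [i] times the identity matrix of size 2 is [diag(-1, 1)] times
    [diag(-i, i)]. *)
Lemma realizable_inv_graded (i : F) (u w : End V) r (f : 'I_r -> V)
    (psi : V -> 'I_r -> F) :
    i * i = -1 -> 2 != 0 :> F ->
    u = 1 + w -> lin_indep f -> (forall a, exists v, f a = w v) ->
    (forall v, w v = \sum_a psi v a *: f a) ->
    realizable i (1%:M + \matrix_(a, b) psi (f b) a) ->
  inv_graded_product (i *: u).
Proof.
move=> ii two0 uw ffree /choice[v fv] wE [c [E [/row_freeP[B EB] gU]]].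
pose D := 1%:M + \matrix_(a, b) psi (f b) a.
rewrite -/D in EB gU.
have uE x : u x = x + w x by rewrite uw.
have wsum m (x : 'I_m -> F) (g : 'I_m -> V) :
    w (\sum_k x k *: g k) = \sum_k x k *: w (g k).
  rewrite (linear_sum (w : {linear V -> V})); apply: eq_bigr => k _.
  exact: (linearZ_LR (w : {linear V -> V})).
have wB x y : w (x - y) = w x - w y by exact: (linearB (w : {linear V -> V})).
have wD x y : w (x + y) = w x + w y by exact: (linearD (w : {linear V -> V})).
pose h (k : 'I_(r + r)) := match fintype.split k with inl a => f a | inr a => v a end.
have hw x : exists d : 'I_(r + r) -> F, w (x - \sum_k d k *: h k) = 0.
  exists (fun k : 'I_(r + r) =>
    match fintype.split k with inl _ => 0 | inr a => psi x a end).
  rewrite wB wsum big_split_ord /= big1 => [|a _]; last first.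
    by rewrite (unsplitK (inl _ : 'I_r + 'I_r)) scale0r.
  rewrite add0r wE; apply/eqP; rewrite subr_eq0; apply/eqP/eq_bigr => a _.
  by rewrite /h (unsplitK (inr _ : 'I_r + 'I_r)) -fv.
have [z [wz zfree]] := kernel_independent hw c.
pose g (j : 'I_c) := \sum_a E a j *: v a + z j.
pose e (k : 'I_(r + c)) := match fintype.split k with inl a => f a | inr j => g j end.
have el a : e (lshift c a) = f a by rewrite /e (unsplitK (inl _ : 'I_r + 'I_c)).
have er j : e (rshift r j) = g j by rewrite /e (unsplitK (inr _ : 'I_r + 'I_c)).
have wg j : w (g j) = \sum_a E a j *: f a.
  by rewrite /g wD wz addr0 wsum; apply: eq_bigr => a _; rewrite -fv.
pose M := row_mx (D - 1%:M) E.
have we k : w (e k) = \sum_a M a k *: f a.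
  rewrite -[k]splitK; case: (fintype.split k) => [b|j] /=.
    rewrite el wE; apply: eq_bigr => a _.
    by rewrite row_mxEl /D addrC addKr mxE.
  by rewrite er wg; apply: eq_bigr => a _; rewrite row_mxEr.
have efree : lin_indep e.
  move=> x; rewrite big_split_ord /=.
  under eq_bigr do rewrite el; under [X in _ + X]eq_bigr do rewrite er scalerDr.
  rewrite big_split /= => x0.
  pose d k := if insub k is Some j then x (rshift r j) else 0.
  have dE (j : 'I_c) : d j = x (rshift r j) by rewrite /d valK.
  have xr j : x (rshift r j) = 0.
    rewrite -dE; apply: (zfree (fun k : 'I_(r + r) =>
      match fintype.split k with
      | inl a => x (lshift c a)
      | inr a => \sum_j x (rshift r j) * E a j end) d) => //.
    rewrite -[RHS]x0 big_split_ord /= -addrA; congr (_ + _).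
      by apply: eq_bigr => a _; rewrite /h (unsplitK (inl _ : 'I_r + 'I_r)).
    congr (_ + _); last by apply: eq_bigr => k _; rewrite dE.
    under eq_bigr do rewrite /h (unsplitK (inr _ : 'I_r + 'I_r)) scaler_suml.
    rewrite exchange_big /=; apply: eq_bigr => k _.
    by rewrite scaler_sumr; apply: eq_bigr => a _; rewrite scalerA.
  have xl : forall a, x (lshift c a) = 0.
    apply: ffree; rewrite -[RHS]x0 -[LHS]addr0; congr (_ + _).
    by rewrite !big1 ?addr0// => j _; rewrite xr scale0r.
  by move=> k; rewrite -[k]splitK; case: (fintype.split k) => [a|j] /=.
have ew x : exists d : 'I_(r + c) -> F, w (x - \sum_k d k *: e k) = 0.
  exists (fun k => \sum_b B k b * psi x b); rewrite wB wsum.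
  under eq_bigr do rewrite we scaler_sumr.
  rewrite exchange_big /=; apply/eqP; rewrite subr_eq0; apply/eqP.
  rewrite wE; apply: eq_bigr => a _.
  under [RHS]eq_bigr do rewrite scalerA.
  rewrite -scaler_suml; congr (_ *: _).
  under eq_bigr do rewrite mulr_suml.
  rewrite exchange_big /=; transitivity (\sum_b (1%:M : 'M_r) a b * psi x b).
    rewrite (bigD1 a)//= mxE eqxx mul1r big1 ?addr0// => b ba.
    by rewrite mxE eq_sym (negPf ba) mul0r.
  apply: eq_bigr => b _; rewrite -EB mxE mulr_suml; apply: eq_bigr => k _.
  by rewrite [RHS]mulrC mulrA.
have [K [b [bw bB]]] := pairing_basis efree ew Vinf.
have gi2 : inv_graded_product (i *: (1%:M : 'M[F]_(1 + 1))).
  apply: (inv_graded_product_left (a := dsum (- 1%:M : 'M_1) (1%:M : 'M_1))).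
    by rewrite -dsumM mulNmx mulmxN opprK !mulmx1 dsum1.
  rewrite mulmx1 dsumZ scalerN scalemx1 -raddfN.
  exact: inverse_scalars_graded.
apply: (model_inv_graded bB gU gi2) => -[k|[x j]] /=.
  rewrite uE -[k]splitK; case: (fintype.split k) => [a|j] /=.
    rewrite el wE big_split_ord /= [X in _ = _ + X]big1 => [|l _]; last first.
      by rewrite mxE block_mxEdl mxE mulr0 scale0r.
    under [X in _ = X + _]eq_bigr do rewrite mxE block_mxEul el -scalerA.
    rewrite addr0 -scaler_sumr; congr (_ *: _).
    under [RHS]eq_bigr do rewrite /D !mxE scalerDl.
    rewrite big_split /=; congr (_ + _).
    rewrite (bigD1 a)//= eqxx scale1r big1 ?addr0// => l /negPf->.
    by rewrite scale0r.
  rewrite er wg big_split_ord /=.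
  under [X in _ = X + _]eq_bigr do rewrite mxE block_mxEur el -scalerA.
  under [X in _ = _ + X]eq_bigr do rewrite mxE block_mxEdr er -scalerA mxE.
  rewrite -!scaler_sumr -scalerDr addrC; congr (_ *: (_ + _)).
  rewrite (bigD1 j)//= eqxx scale1r big1 ?addr0// => l /negPf->.
  by rewrite scale0r.
rewrite uE bw addr0 (bigD1 j)//= !mxE eqxx mulr1 big1 ?addr0// => l lj.
by rewrite !mxE (negPf lj) mulr0 scale0r.
Qed.

Lemma SPf_inv_graded (i : F) (u : End V) : i * i = -1 -> 2 != 0 :> F ->
  SPf u -> SPf_det u ^+ 4 = 1 -> inv_graded_product (i *: u).
Proof.
move=> ii two0 uSP; have [_ detP] := SPf_detP uSP.
case: uSP => _ [w wfin uw] u4.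
have [r [f [ffree fw /choice[psi psiP]]]] := image_basis wfin.
apply: (realizable_inv_graded ii two0 uw ffree fw psiP).
apply: (realizable_fourth ii two0); set D := 1%:M + _.
suff -> : \det D = SPf_det u by [].
rewrite -det_tr; apply: detP; exists r, f, D^T; split=> //.
  by move=> v; exists (psi v); rewrite uw addrC addKr.
move=> a; rewrite uw End_addE End_oneE psiP.
under [RHS]eq_bigr do rewrite !mxE scalerDl.
rewrite big_split /=; congr (_ + _).
rewrite (bigD1 a)//= eqxx scale1r big1 ?addr0// => l /negPf->.
by rewrite scale0r.
Qed.

End Assembly.

Theorem proposition1p16 (F : fieldType) (V : lmodType F)
    (Vinf : infinite_dimensional V)
    (i : F) (i_order4 : 4.-primitive_root i)
    (u : End V) (uSP : SPf u) (u_det : SPf_det u \in [:: 1; -1; i; - i]) :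
  [/\ exists a b c : End V,
        [/\ is_involution a, is_involution b, is_involution c
          & i *: u = a * b * c],
      exists a b c : End V,
        [/\ is_involution a, is_unipotent2 b, is_unipotent2 c
          & i *: u = a * b * c],
      exists a b c : End V,
        [/\ is_unipotent2 a, is_involution b, is_unipotent2 c
          & i *: u = a * b * c]
    & exists a b c : End V,
        [/\ is_unipotent2 a, is_unipotent2 b, is_involution c
          & i *: u = a * b * c]].
Proof.
have i2 : i ^+ 2 != 1 by rewrite -(prim_order_dvd i_order4).
have ii : i * i = -1.
  have := prim_expr_order i_order4; rewrite (exprM i 2 2) => /eqP.
  by rewrite sqrf_eq1 (negPf i2) => /eqP.
have two0 : 2 != 0 :> F.
  apply: contra i2 => /eqP two0; rewrite expr2 ii -subr_eq0 -opprD oppr_eq0.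
  by rewrite -two0.
apply: three_factors; apply: (SPf_inv_graded Vinf ii two0 uSP).
have i4 : i ^+ 4 = 1 by exact: prim_expr_order.
have N4 (x : F) : (- x) ^+ 4 = x ^+ 4 by rewrite (exprM _ 2 2) sqrrN -exprM.
by move: u_det; rewrite !inE => /or4P[] /eqP->; rewrite ?N4 ?expr1n.
Qed.
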